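(* Let $$K(x,y)=\sum_{l,n\ge 0}\frac{K_n^l}{l!\,n!}x^ly^n$$ be the exponential generating function in two variables of the numbers $K_n^l$ of connected components of the sets of very nice M-morsifications of $B_n^l$. Then $K(x,y)$ satisfies (as a formal power series) $$K_x=(1-2x)K_{yy}-xyK_{yyy},$$ where subscripts denote partial derivatives.
   Context: For an integer $n\ge 1$ let $P_n$ be the space of real polynomials of the form $x^n+\lambda_2x^{n-2}+\cdots+\lambda_{n-1}x$, with the topology of the coefficients $\lambda_i\in\mathbb R$ (so $P_1=\{x\}$, $P_2=\{x^2\}$). For $l\ge 0$ consider pairs $(f;b_1,\dots,b_l)\in P_n\times\mathbb R^l$; the $b_i$ are the (labelled) boundary points and the numbers $f(b_i)$ are the boundary values. Such a pair is a very nice M-morsification of $B_n^l$ if all $n-1$ critical points of $f$ (counted with multiplicity) are real and the $n-1$ critical values together with the $l$ boundary values are all pairwise distinct. $K_n^l$ is the number of connected components of the set of very nice M-morsifications of $B_n^l$, as a subspace of $P_n\times\mathbb R^l$. For $n=0$, $K_0^l$ (for $l\ge1$) is the number of connected components of the space of degree $0$ polynomials (the zero polynomial) with $l$ labelled real boundary points having pairwise distinct boundary values; thus $K_0^1=1$ and $K_0^l=0$ for $l\ge 2$; $K_0^0$ is an arbitrary constant. With $K_m$ the Bernoulli-Euler numbers, $\sec t+\tan t=\sum_{m\ge0}K_mt^m/m!$, it is known (Arnold) that $K_n^0=K_{n-1}$ for $n\ge1$ and $K_n^1=K_{n+1}$ for $n\ge0$. *)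

(* Defs.v *)
From HB Require Import structures.
From mathcomp Require Import all_boot all_order all_algebra finmap.
From mathcomp Require Import all_classical all_reals.
From mathcomp Require Import topology normedtype.

Set Implicit Arguments.
Unset Strict Implicit.
Unset Printing Implicit Defensive.

Import Order.TTheory GRing.Theory Num.Theory.
Import numFieldNormedType.Exports.
Local Open Scope classical_set_scope.
Local Open Scope ring_scope.

(* The polynomial x^n + lambda_2 x^(n-2) + ... + lambda_(n-1) x of P_n; the
   entry i of the row vector is lambda_(i+2), so P_n is coordinatized by
   R^(n-2) (a point if n <= 2).  For n = 0 it is the zero polynomial. *)
Definition Ppoly (R : realType) (n : nat) (lam : 'rV[R]_(n - 2)) : {poly R} :=
  if n == 0%N then 0
  else 'X^n + \sum_(i < n - 2) lam 0 i *: 'X^(n - 2 - i).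
Arguments Ppoly {R} n lam.

(* The sequence s lists the critical points with multiplicity: f' splits over R
   with roots s.  For n = 0 there are none, and only the boundary values are
   required to be distinct. *)
Definition very_nice (R : realType) (n l : nat) :
    set ('rV[R]_(n - 2) * 'rV[R]_l) :=
  [set fb : 'rV[R]_(n - 2) * 'rV[R]_l | let f := Ppoly n fb.1 in
    exists s : seq R,
      [/\ size s = n.-1,
          f^`() = n%:R *: \prod_(c <- s) ('X - c%:P)
        & uniq ([seq f.[c] | c <- s] ++ [seq f.[fb.2 0 i] | i <- enum 'I_l])]].
Arguments very_nice R n l : clear implicits.

Definition components (T : topologicalType) (A : set T) : set (set T) :=
  [set connected_component A x | x in A].

(* K_n^l; meaningful because the set of components is finite. *)
Definition numK (R : realType) (l n : nat) : nat :=
  #|` fset_set (components (very_nice R n l))|%fset.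

(* Formal power series in x and y: f i j is the coefficient of x^i y^j.
   The operations are given their own scope since the ring structure on
   functions is pointwise. *)
Definition fps2 (R : Type) := nat -> nat -> R.

Declare Scope fps2_scope.
Delimit Scope fps2_scope with FPS.
Bind Scope fps2_scope with fps2.

Section FPS2.
Variable R : comNzRingType.
Implicit Types f g : fps2 R.

Definition fps2C (c : R) : fps2 R :=
  fun i j => if (i == 0%N) && (j == 0%N) then c else 0.
Definition fps2X : fps2 R := fun i j => ((i == 1%N) && (j == 0%N))%:R.
Definition fps2Y : fps2 R := fun i j => ((i == 0%N) && (j == 1%N))%:R.
Definition fps2_sub f g : fps2 R := fun i j => f i j - g i j.
Definition fps2_mul f g : fps2 R :=
  fun i j => \sum_(p < i.+1) \sum_(q < j.+1) f p q * g (i - p)%N (j - q)%N.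
Definition fps2_dx f : fps2 R := fun i j => f i.+1 j *+ i.+1.
Definition fps2_dy f : fps2 R := fun i j => f i j.+1 *+ j.+1.
End FPS2.

Arguments fps2C {R} c%_R.
Arguments fps2X {R}.
Arguments fps2Y {R}.

Notation "f - g" := (fps2_sub f g) : fps2_scope.
Notation "f * g" := (fps2_mul f g) : fps2_scope.

(* The generating function K(x, y), with K_0^0 := K00. *)
Definition genK (R : realType) (K00 : R) : fps2 R :=
  fun l n => (if (l == 0%N) && (n == 0%N) then K00 else (numK R l n)%:R)
               / (l`! * n`!)%:R.

(* Main.v *)
(* Write n = m + 1.  Sorting the m critical points and the l boundary points by
   abscissa, the values of f at these points form a permutation of m + l letters
   whose turning points (local extrema, with the convention +oo on the right and
   (-1)^n oo on the left) are the critical points.  The components correspond to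
   the permutations with exactly m turning points together with a labelling of
   the other points, and inserting a new maximal letter gives the recurrence
     K_n^(l+1) = K_(n+2)^l - l (n + 2) K_(n+2)^(l-1),
   which is the coefficientwise form of the differential equation.

   A cell is connected because a monic centred polynomial with real critical
   points c is determined, continuously, by the heights w_i(c) of its monotone
   pieces, and all positive heights occur.  If w_i(d) >= w_i(c) for all i then
   <c, d> >= <c, c>: transporting the piece of f_c onto that of f_d and using the
   AM-GM inequality, the first variation of every w_i(c) in the direction d - c
   is nonnegative, and by Lagrange interpolation the coefficient of x^(n-2)
   then varies with the sign of - <c, d - c>.  Hence c is the point of least
   norm among the d with w(d) >= w(c); this gives uniqueness, a modulus of
   continuity, and existence by minimization. *)

Require Import Defs.
From mathcomp Require Import all_boot all_order all_algebra all_fingroup.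
From mathcomp Require Import all_classical all_reals topology normedtype.
From mathcomp Require Import derive realfun finmap polyrcf.
From mathcomp Require Import ring lra zify.
Import Order.TTheory GRing.Theory Num.Theory.
Import numFieldNormedType.Exports.

Set Implicit Arguments.
Unset Strict Implicit.
Unset Printing Implicit Defensive.

Local Open Scope classical_set_scope.
Local Open Scope ring_scope.

(** * The critical values determine the polynomial *)

(** Value vectors with a fixed order type form a convex set, so a cell is connected as soon as
    configurations depend continuously on the values at their special points. The inversion behind
    this (uniqueness, continuity, existence) rests on one inequality instead of the implicit
    function theorem or a degree argument. Homogeneity makes it quantitative: dilating the critical
    points by r multiplies every height by r^(m+1), so heights that agree up to such a factor allow
    comparing c with r d and d with r c. For existence, the minimizer must be shown to have no
    slack: a perturbation prescribed by its values at the old critical points trades slack in one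
    height for a gain in the others, and the Lagrange signs make the norm decrease. In the count, a
    new maximal letter keeps the number of turns exactly when it takes over from an adjacent peak or
    prolongs a monotone run at an end. Passing from n to n + 2 preserves the parity of n, hence the
    left sentinel, so the recurrence never mixes the two conventions. *)

Section BranchInverse.
Variable R : realType.
Implicit Types p q : {poly R}.

Lemma deriv_gt0_incr p (a b : R) : (forall x, a < x < b -> 0 < (deriv p).[x]) ->
  forall x y, a <= x -> x < y -> y <= b -> p.[x] < p.[y].
Proof.
move=> dp x y ax xy yb; rewrite -subr_gt0.
have [z /itvP zxy ->] := poly_mvt p xy.
by rewrite mulr_gt0 ?subr_gt0 // dp // (le_lt_trans ax) ?zxy // (lt_le_trans _ yb) ?zxy.
Qed.

Lemma deriv_gt0_ndecr p (a b : R) : (forall x, a < x < b -> 0 < (deriv p).[x]) ->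
  forall x y, a <= x -> x <= y -> y <= b -> p.[x] <= p.[y].
Proof.
move=> dp x y ax; rewrite le_eqVlt => /predU1P[->//|xy] yb.
exact/ltW/(deriv_gt0_incr dp).
Qed.

Lemma deriv_gt0_inj p (a b : R) : (forall x, a < x < b -> 0 < (deriv p).[x]) ->
  forall x y, a <= x <= b -> a <= y <= b -> p.[x] = p.[y] -> x = y.
Proof.
move=> dp x y /andP[ax xb] /andP[ay yb] pxy.
have [xy|yx|//] := ltgtP x y.
  by have := deriv_gt0_incr dp ax xy yb; rewrite pxy ltxx.
by have := deriv_gt0_incr dp ay yx xb; rewrite pxy ltxx.
Qed.

Lemma branch_ivt p (a b : R) u : a <= b -> p.[a] <= u <= p.[b] ->
  exists2 y, a <= y <= b & p.[y] = u.
Proof.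
move=> ab /andP[au ub].
have [|y yab /rootP] := @polyrcf.poly_ivt _ (p - u%:P) a b ab.
  by rewrite !hornerE mulr_le0_ge0 ?subr_ge0 ?subr_le0.
rewrite !hornerE => /eqP; rewrite subr_eq0 => /eqP <-.
by exists y => //; rewrite !(itvP yab).
Qed.

(* The change of variable y = h x matching the increments of p on [a, b] with
   those of q on [a', b'] satisfies h' = theta * p' / q'; the hypothesis says
   that x |-> D x + p' x * (h x - x) is nondecreasing. *)
Lemma transport_le p q (D : {poly R}) (a b a' b' theta : R) :
  a < b -> a' < b' ->
  (forall x, a < x < b -> 0 < (deriv p).[x]) ->
  (forall y, a' < y < b' -> 0 < (deriv q).[y]) ->
  q.[b'] - q.[a'] = theta * (p.[b] - p.[a]) ->
  (forall x y, a < x < b -> a' < y < b' ->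
     0 <= (deriv D).[x] + (deriv (deriv p)).[x] * (y - x)
          + (deriv p).[x] * (theta * (deriv p).[x] / (deriv q).[y] - 1)) ->
  D.[a] + (deriv p).[a] * (a' - a) <= D.[b] + (deriv p).[b] * (b' - b).
Proof.
move=> ab a'b' dp dq thE dphi.
have pab : p.[a] < p.[b] by apply: deriv_gt0_incr dp _ _ _ _ _.
have qab : q.[a'] < q.[b'] by apply: deriv_gt0_incr dq _ _ _ _ _.
have th0 : 0 < theta.
  by rewrite -(@pmulr_lgt0 _ (p.[b] - p.[a])) -?thE subr_gt0.
(* [t] is [p] followed by the affine map taking its range on [a, b] to that of [q] on [a', b']; the
   change of variable [h] is the inverse branch [gi] of [q] applied to [t]. *)
pose t : {poly R} := q.[a']%:P + theta *: (p - p.[a]%:P).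
have tE x : t.[x] = q.[a'] + theta * (p.[x] - p.[a]) by rewrite /t !hornerE.
have ta : t.[a] = q.[a'] by rewrite tE subrr mulr0 addr0.
have tb : t.[b] = q.[b'] by rewrite tE -thE; ring.
have dtE : deriv t = theta *: deriv p.
  by rewrite /t derivD derivC derivZ derivB derivC subr0 add0r.
have dt x : a < x < b -> 0 < (deriv t).[x].
  by move=> xab; rewrite dtE hornerZ mulr_gt0 // dp.
pose gi u := xget a' [set y | a' <= y <= b' /\ q.[y] = u].
have giP u : q.[a'] <= u <= q.[b'] -> a' <= gi u <= b' /\ q.[gi u] = u.
  move=> /(branch_ivt (ltW a'b'))[y yab yu].
  by rewrite /gi; case: xgetP => [z _ //|/(_ y)[]].
have gK y : a' <= y <= b' -> gi q.[y] = y.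
  move=> yab; have [] := giP q.[y].
    by case/andP: yab => ay yb; rewrite !(deriv_gt0_ndecr dq).
  by move=> h1 h2; apply: (deriv_gt0_inj dq).
have tab x : a <= x <= b -> q.[a'] <= t.[x] <= q.[b'].
  by case/andP=> ax xb; rewrite -ta -tb !(deriv_gt0_ndecr dt).
pose h x := gi t.[x].
have ha : h a = a' by rewrite /h ta gK // lexx ltW.
have hb : h b = b' by rewrite /h tb gK // lexx ltW.
have hP x : a <= x <= b -> a' <= h x <= b' /\ q.[h x] = t.[x].
  by move=> /tab /giP.
have hmono x y : a <= x <= b -> a <= y <= b -> x < y -> h x < h y.
  move=> xab yab xy; rewrite ltNge; apply/negP => hyx.
  have [hx qx] := hP _ xab; have [hy qy] := hP _ yab.
  case/andP: (xab) => ax _; case/andP: (yab) => _ yb.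
  have := deriv_gt0_incr dt ax xy yb; rewrite -qx -qy.
  move: hyx; rewrite le_eqVlt => /predU1P[->|hyx]; first by rewrite ltxx.
  case/andP: hx => _ hx; case/andP: hy => hy _.
  by have := deriv_gt0_incr dq hy hyx hx; lra.
have hin x : a < x < b -> a' < h x < b'.
  move=> xab; rewrite -ha -hb !hmono //; lra.
(* Continuity up to the ends comes from monotonicity and surjectivity: the derivative of [h] is
   available only inside, since that of [q] may vanish at a' and b'. *)
have hcont : {within `[a, b], continuous h}.
  apply: segment_inc_surj_continuous.
    move=> x y; rewrite !in_itv /= => xab yab.
    apply/idP/idP => [|].
      by rewrite !leNgt; apply: contra => /(hmono _ _ yab xab).
    by rewrite le_eqVlt => /predU1P[->//|/(hmono _ _ xab yab)/ltW].
  move=> y /=; rewrite ha hb in_itv /= => yab.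
  have [|x xab tx] := @branch_ivt t a b q.[y] (ltW ab).
    by case/andP: yab => ay yb; rewrite ta tb !(deriv_gt0_ndecr dq).
  by exists x; rewrite /= ?in_itv //= /h tx gK.
have hder x : a < x < b ->
    is_derive x 1 h ((deriv q).[h x]^-1 * (theta * (deriv p).[x])).
  move=> xab; apply: is_derive1_comp.
    have [|_ <-] := hP x; first by lra.
    apply: is_derive_inverse.
    - have yab : h x \in `]a', b'[ by rewrite in_itv /= hin.
      apply: filterS (near_in_itvoo yab) => y; rewrite in_itv /= => /andP[? ?].
      by rewrite gK // !ltW.
    - by near=> y; apply: continuous_horner.
    - by rewrite gt_eqF // dq // hin.
  have -> : theta * (deriv p).[x] = (deriv t).[x] by rewrite dtE hornerZ.
  exact: is_derive_poly.
pose phi : R -> R := horner D + horner (deriv p) * (h - id).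
have phid x : x \in `]a, b[ -> is_derive x 1 phi ((deriv D).[x] +
   ((deriv p).[x] *: ((deriv q).[h x]^-1 * (theta * (deriv p).[x]) - 1)
    + (h x - x) *: (deriv (deriv p)).[x])).
  rewrite in_itv /= => xab; have := hder x xab => ?.
  apply: (@is_deriveD _ _ _ (horner D) (horner (deriv p) * (h - id))).
  apply: (@is_deriveM _ _ (horner (deriv p)) (h - id)).
rewrite -ha -hb.
apply: (@ger0_derive1_le_cc _ phi a b); rewrite ?in_itv /= ?lexx ?ltW //.
- by move=> x /phid [].
- move=> x xab; have := phid x xab => ?; rewrite derive1E derive_val.
  move: xab; rewrite in_itv /= => xab; have := dphi x (h x) xab (hin _ xab).
  by rewrite /GRing.scale /=; congr (0 <= _); ring.
- have cH r : {within `[a, b], continuous (horner r)}.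
    exact/continuous_subspaceT/continuous_horner.
  move=> x; apply: continuousD; first exact: cH.
  apply: continuousM; first exact: cH.
  apply: continuousB; first exact: hcont.
  by move: x; apply: continuous_subspaceT => y; exact: cvg_id.
Unshelve. all: by end_near. Qed.

End BranchInverse.

(** * Products of linear factors, slots and Lagrange interpolation *)

Section CritProd.
Variable R : realType.
Implicit Types (c d : nat -> R) (p q : {poly R}).

(* The constant coefficient is p`_0 / 0 = 0. *)
Definition prim p : {poly R} := \poly_(i < (size p).+1) (p`_i.-1 / i%:R).

Lemma deriv_prim p : deriv (prim p) = p.
Proof.
apply/polyP => i; rewrite coef_deriv coef_poly ltnS.
case: ltnP => [_|h]; last by rewrite mul0rn nth_default.
by rewrite -(mulr_natr (_ / _)) divfK // pnatr_eq0.
Qed.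

Lemma prim0 p : (prim p).[0] = 0.
Proof. by rewrite horner_coef0 coef_poly /= invr0 mulr0. Qed.

Lemma deriv_eq_horner p q : deriv p = deriv q ->
  forall x y, p.[x] - p.[y] = q.[x] - q.[y].
Proof.
move=> e x y; wlog xy : x y / x < y => [H|].
  by have [/H//|/H h|->] := ltgtP x y; lra.
have [z _] := poly_mvt (p - q) xy.
by rewrite derivB e subrr horner0 mul0r !hornerE; lra.
Qed.

(** Points are total sequences of which the first [m] entries count, so that omitting the j-th point
    is plain composition with [bump j]. *)
Definition cprod c m : {poly R} := \prod_(j < m) ('X - (c j)%:P).

Lemma cprod0 c : cprod c 0 = 1. Proof. by rewrite /cprod big_ord0. Qed.

Lemma cprodS c m : cprod c m.+1 = cprod c m * ('X - (c m)%:P).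
Proof. by rewrite /cprod big_ord_recr. Qed.

Lemma eq_cprod c d m : (forall j, (j < m)%N -> c j = d j) -> cprod c m = cprod d m.
Proof. by move=> e; apply: eq_bigr => j _; rewrite e. Qed.

Lemma monic_cprod c m : cprod c m \is monic.
Proof. exact: monic_prod_XsubC. Qed.

Lemma size_cprod c m : size (cprod c m) = m.+1.
Proof. by rewrite size_prod_XsubC /index_enum -enumT size_enum_ord. Qed.

Lemma cprod_seq c m : cprod c m = \prod_(x <- [seq c i | i <- iota 0 m]) ('X - x%:P).
Proof.
by rewrite big_map /cprod -(big_mkord xpredT (fun i => 'X - (c i)%:P)) /index_iota subn0.
Qed.

Lemma horner_cprod c m x : (cprod c m).[x] = \prod_(j < m) (x - c j).
Proof. by rewrite horner_prod; apply: eq_bigr => j _; rewrite !hornerE. Qed.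

Lemma cprod_lead c m : (cprod c m)`_m = 1.
Proof. by have /monicP := monic_cprod c m; rewrite lead_coefE size_cprod. Qed.

Lemma cprod_coef1 c m : (cprod c m.+1)`_m = - \sum_(j < m.+1) c j.
Proof.
elim: m => [|m IH]; rewrite cprodS mulrBr coefB coefMX coefMC.
  by rewrite cprod0 coef1 big_ord1 /= sub0r mul1r.
by rewrite /= IH cprod_lead mul1r [in RHS]big_ord_recr /= opprD.
Qed.

(** The second elementary symmetric function through power sums. For centred points it is minus half
    the sum of squares, which ties this coefficient to the norm being minimized. *)
Lemma cprod_coef2 c m : (cprod c m.+2)`_m =
  ((\sum_(j < m.+2) c j) ^+ 2 - \sum_(j < m.+2) c j ^+ 2) / 2.
Proof.
elim: m => [|m IH]; rewrite cprodS mulrBr coefB coefMX coefMC.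
  by rewrite /= cprod_coef1 !big_ord_recr !big_ord0 /=; field.
by rewrite /= IH cprod_coef1 [\sum_(j < m.+3) c j]big_ord_recr [\sum_(j < m.+3) c j ^+ 2]big_ord_recr /=; field.
Qed.

Lemma cprod_bump c m j : (j < m)%N ->
  cprod c m = ('X - (c j)%:P) * cprod (c \o bump j) m.-1.
Proof.
by case: m => // m jm; rewrite /cprod (bigD1_ord (Ordinal jm)).
Qed.

Lemma deriv_cprod c m : deriv (cprod c m) = \sum_(j < m) cprod (c \o bump j) m.-1.
Proof.
elim: m => [|m IH]; first by rewrite cprod0 derivC big_ord0.
rewrite cprodS derivM derivXsubC mulr1 IH big_ord_recr /=; congr (_ + _).
  rewrite mulr_suml; apply: eq_bigr => j _.
  case: m j {IH} => [[]//|m] j; rewrite cprodS /=; congr (_ * ('X - (c _)%:P)).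
  by rewrite /bump -ltnS ltn_ord.
by apply: eq_cprod => j jm /=; rewrite /bump leqNgt jm.
Qed.

Definition inc c m := forall i j, (i < j)%N -> (j < m)%N -> c i < c j.

Lemma inc_step c m : (forall i, (i.+1 < m)%N -> c i < c i.+1) -> inc c m.
Proof.
move=> h i j; elim: j => // j IH; rewrite ltnS leq_eqVlt => /predU1P[->|ij] jm.
  exact: h.
by apply: lt_trans (h _ jm); apply: IH => //; apply: ltn_trans jm.
Qed.

Lemma inc_le c m i j : inc c m -> (i <= j)%N -> (j < m)%N -> c i <= c j.
Proof. by move=> h; rewrite leq_eqVlt => /predU1P[->//|ij] jm; exact/ltW/h. Qed.

(** The points cut the line into m + 1 open slots; slot [i] has exactly the first [i] of them on its
    left. *)
Definition inslot c m i x :=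
  forall j, (j < m)%N -> if (j < i)%N then c j < x else x < c j.

Lemma cprod_slot_sign c m i x : inslot c m i x ->
  0 < (-1) ^+ (m - i) * (cprod c m).[x].
Proof.
elim: m => [|m IH] h; first by rewrite cprod0 sub0n mul1r hornerC ltr01.
have {}IH := IH (fun j jm => h j (ltnW jm)).
have := h m (ltnSn m); rewrite cprodS hornerM hornerXsubC.
case: ltnP => [mi|im] hm.
  have -> : (m.+1 - i = m - i)%N by lia.
  by rewrite mulrA mulr_gt0 // subr_gt0.
rewrite subSn // exprS.
have -> : -1 * (-1) ^+ (m - i) * ((cprod c m).[x] * (x - c m)) =
  ((-1) ^+ (m - i) * (cprod c m).[x]) * (c m - x) by ring.
by rewrite mulr_gt0 // subr_gt0.
Qed.

Lemma inslot_between c m i x : inc c m -> (i.+1 < m)%N -> c i < x < c i.+1 ->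
  inslot c m i.+1 x.
Proof.
move=> hc im /andP[ix xi] j jm; case: ltnP => ij.
  by apply: le_lt_trans ix; apply: inc_le hc _ _ => //; lia.
by apply: lt_le_trans xi _; apply: inc_le hc _ _ => //; lia.
Qed.

(** The point [c i] lies in slot [i] of the remaining points, which gives the alternating signs of
    the Lagrange denominators. *)
Lemma cprod_lag_sign c m i : inc c m -> (i < m)%N ->
  0 < (-1) ^+ (m - i.+1) * (cprod (c \o bump i) m.-1).[c i].
Proof.
move=> hc im; have -> : (m - i.+1 = m.-1 - i)%N by lia.
apply: cprod_slot_sign => j jm /=; rewrite /bump.
by case: ltnP => ij; [apply: hc | apply: hc]; lia.
Qed.

Lemma lag_neq0 c m i : inc c m -> (i < m)%N -> (cprod (c \o bump i) m.-1).[c i] != 0.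
Proof.
move=> hc im; have := cprod_lag_sign hc im.
by apply: contraTneq => ->; rewrite mulr0 ltxx.
Qed.

Definition interp c m (y : nat -> R) : {poly R} :=
  \sum_(i < m) (y i / (cprod (c \o bump i) m.-1).[c i]) *: cprod (c \o bump i) m.-1.

Lemma size_interp c m y : (size (interp c m y) <= m)%N.
Proof.
apply: (leq_trans (size_sum _ _ _)); apply/bigmax_leqP => i _.
by rewrite (leq_trans (size_scale_leq _ _)) // size_cprod prednK //; case: i; case: m.
Qed.

Lemma horner_interp c m y i : inc c m -> (i < m)%N -> (interp c m y).[c i] = y i.
Proof.
move=> hc im; rewrite horner_sum (bigD1 (Ordinal im)) //= big1 ?addr0.
  by rewrite hornerZ divfK // lag_neq0.
move=> j /negP ji; rewrite hornerZ.
suff -> : (cprod (c \o bump j) m.-1).[c i] = 0 by rewrite mulr0.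
have nij : i != j by apply/negP => /eqP e; apply: ji; apply/eqP/val_inj.
have um : (unbump j i < m.-1)%N.
  by rewrite /unbump; have := ltn_ord j; case: ltnP => /=; lia.
rewrite horner_cprod (bigD1 (Ordinal um)) //=.
by rewrite unbumpK ?subrr ?mul0r // inE.
Qed.

Lemma interp_eq c m p : inc c m -> (size p <= m)%N ->
  p = interp c m (fun i => p.[c i]).
Proof.
move=> hc sp; apply/eqP; rewrite -subr_eq0; apply/eqP.
apply: (@roots_geq_poly_eq0 _ _ [seq c i | i <- iota 0 m]).
- apply/allP => x /mapP[i]; rewrite mem_iota add0n => /andP[_ im] ->.
  by rewrite rootE !hornerE (@horner_interp _ _ (fun i => p.[c i])) // subrr.
- rewrite map_inj_in_uniq ?iota_uniq // => i j.
  rewrite !mem_iota !add0n /= => im jm e.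
  by have [ij|ji|//] := ltngtP i j; [have := hc _ _ ij jm|have := hc _ _ ji im];
    rewrite e ltxx.
- rewrite size_map size_iota (leq_trans (size_polyD _ _)) // size_polyN.
  by rewrite geq_max sp size_interp.
Qed.

Lemma lead_interp c m p : inc c m.+1 -> (size p <= m.+1)%N ->
  p`_m = \sum_(i < m.+1) p.[c i] / (cprod (c \o bump i) m).[c i].
Proof.
move=> hc sp; rewrite {1}(interp_eq hc sp) /interp coef_sum.
by apply: eq_bigr => i _; rewrite coefZ cprod_lead mulr1.
Qed.

(** The Lagrange denominators alternate as the values of [p] do, so all terms of the coefficient of
    degree [m] have one sign, and a zero sum makes each of them vanish. *)
Lemma lead_alt_le0 c m p : inc c m.+1 -> (size p <= m.+1)%N ->
  (forall i, (i <= m)%N -> (-1) ^+ (m - i) * p.[c i] <= 0) ->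
  p`_m <= 0 /\ (p`_m = 0 -> forall i, (i <= m)%N -> p.[c i] = 0).
Proof.
move=> hc sp hs.
have term i : (i <= m)%N -> p.[c i] / (cprod (c \o bump i) m).[c i] <= 0.
  move=> im; have := cprod_lag_sign hc im; rewrite subSS /= => lg.
  have -> : p.[c i] / (cprod (c \o bump i) m).[c i] =
     ((-1) ^+ (m - i) * p.[c i]) / ((-1) ^+ (m - i) * (cprod (c \o bump i) m).[c i]).
    by rewrite -mulf_div divff ?mul1r // signr_eq0.
  by rewrite mulr_le0_ge0 ?hs // invr_ge0 ltW.
rewrite (lead_interp hc sp); split.
  by apply: sumr_le0 => i _; apply: term; rewrite -ltnS.
move=> /eqP; rewrite -oppr_eq0 -sumrN psumr_eq0; last first.
  by move=> i _; rewrite oppr_ge0 term // -ltnS.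
move=> /allP h i im; have := h (Ordinal (im : i < m.+1)%N) (mem_index_enum _).
by rewrite oppr_eq0 mulf_eq0 invr_eq0 (negPf (lag_neq0 hc im)) orbF => /eqP.
Qed.

End CritProd.

(** * Heights of the monotone pieces and their first variation *)

Section Width.
Variable R : realType.
Implicit Types (c d : nat -> R) (p q : {poly R}).

Definition critpoly c m : {poly R} := prim (m.+1%:R *: cprod c m).

Lemma deriv_critpoly c m : deriv (critpoly c m) = m.+1%:R *: cprod c m.
Proof. exact: deriv_prim. Qed.

Lemma critpoly0 c m : (critpoly c m).[0] = 0. Proof. exact: prim0. Qed.

Lemma eq_critpoly c d m : (forall j, (j < m)%N -> c j = d j) ->
  critpoly c m = critpoly d m.
Proof. by move=> e; rewrite /critpoly (eq_cprod e). Qed.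

(* The sign is that of the derivative between c i and c i.+1. *)
Definition width c m i : R := (-1) ^+ (m - i.+1) *
  ((critpoly c m).[c i.+1] - (critpoly c m).[c i]).

Lemma critpoly_slot_sign c m i x : inslot c m i x ->
  0 < (-1) ^+ (m - i) * (deriv (critpoly c m)).[x].
Proof.
move=> /cprod_slot_sign h.
by rewrite deriv_critpoly hornerZ mulrCA mulr_gt0 // ltr0n.
Qed.

Lemma critpoly_mono c m i x y : x < y ->
  (forall z, x < z < y -> inslot c m i z) ->
  0 < (-1) ^+ (m - i) * ((critpoly c m).[y] - (critpoly c m).[x]).
Proof.
move=> xy h; have := @deriv_gt0_incr R ((-1) ^+ (m - i) *: critpoly c m) x y.
rewrite derivZ => /(_ _ x y (lexx _) xy (lexx _)).
rewrite !hornerZ mulrBr subr_gt0; apply => z zxy.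
by rewrite hornerZ; apply/critpoly_slot_sign/h.
Qed.

Lemma width_gt0 c m i : inc c m -> (i.+1 < m)%N -> 0 < width c m i.
Proof.
move=> hc im; apply: critpoly_mono => [|z]; first exact: hc.
exact: inslot_between.
Qed.

Lemma sum_ge_prod1 n (e : 'I_n -> R) : (0 < n)%N -> (forall i, 0 <= e i) ->
  1 <= \prod_i e i -> n%:R <= \sum_i e i.
Proof.
move=> n0 e0 pe; have [] := @leif_AGM R 'I_n predT e (fun i _ => e0 i).
rewrite card_ord => /(le_trans pe); rewrite expr_ge1 //; last first.
  by rewrite divr_ge0 ?ler0n // sumr_ge0.
by rewrite ler_pdivlMr ?ltr0n // mul1r.
Qed.

(* Derivative of the first variation of [critpoly c m] when the critical points
   move with velocity xi. *)
Definition variation c (xi : nat -> R) m : {poly R} :=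
  - (m.+1%:R *: \sum_(j < m) xi j *: cprod (c \o bump j) m.-1).

Lemma horner_variation c xi m x : (forall j, (j < m)%N -> x != c j) ->
  (variation c xi m).[x] =
  - (m.+1%:R * (cprod c m).[x]) * \sum_(j < m) xi j / (x - c j).
Proof.
move=> hx; rewrite /variation hornerN hornerZ horner_sum mulNr -mulrA [(cprod c m).[x] * _]mulr_sumr.
congr (- (_ * _)); apply: eq_bigr => j _; rewrite hornerZ.
rewrite (@cprod_bump _ c m j (ltn_ord j)) hornerM hornerXsubC.
by field; rewrite subr_eq0 hx.
Qed.

Lemma horner_deriv_cprod c m x : (forall j, (j < m)%N -> x != c j) ->
  (deriv (cprod c m)).[x] = (cprod c m).[x] * \sum_(j < m) (x - c j)^-1.
Proof.
move=> hx; rewrite deriv_cprod horner_sum mulr_sumr; apply: eq_bigr => j _.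
rewrite (@cprod_bump _ c m j (ltn_ord j)) hornerM hornerXsubC.
by field; rewrite subr_eq0 hx.
Qed.

(** The m + 1 positive numbers given to AM-GM are the ratios (y - d_j) / (x - c_j) and theta p'(x) /
    q'(y), with p and q the two signed polynomials. The ratios multiply to q'(y) / p'(x), so the
    whole product is theta, the quotient of the two heights, which is at least 1. The quantity
    required by [transport_le] is p'(x) times the sum of these numbers minus m + 1. *)
Lemma variation_width c d m i : inc c m -> inc d m -> (i.+1 < m)%N ->
  width c m i <= width d m i ->
  let V := prim (variation c (fun j => d j - c j) m) in
  0 <= (-1) ^+ (m - i.+1) * (V.[c i.+1] - V.[c i]).
Proof.
move=> hc hd im wcd; set V := prim _; move=> /=.
set s : R := (-1) ^+ (m - i.+1).
have wc0 := width_gt0 hc im.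
have crit0 e k : (k < m)%N -> (deriv (s *: critpoly e m)).[e k] = 0.
  move=> km; rewrite derivZ deriv_critpoly !hornerZ (cprod_bump _ km).
  by rewrite hornerM hornerXsubC subrr mul0r !mulr0.
have dpos e x : inc e m -> e i < x < e i.+1 -> 0 < (deriv (s *: critpoly e m)).[x].
  move=> he ex; rewrite derivZ hornerZ; apply: critpoly_slot_sign.
  exact: inslot_between.
pose theta := width d m i / width c m i.
have th1 : 1 <= theta by rewrite ler_pdivlMr ?mul1r.
have := @transport_le R (s *: critpoly c m) (s *: critpoly d m) (s *: V)
  (c i) (c i.+1) (d i) (d i.+1) theta (hc _ _ (ltnSn i) im) (hd _ _ (ltnSn i) im)
  (fun x => dpos c x hc) (fun x => dpos d x hd).
(* The ends of the piece are critical, so the displacement terms of [transport_le] vanish and only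
   the increment of [V] remains. *)
rewrite (crit0 c i (ltnW im)) (crit0 c i.+1 im) !mul0r !addr0 !hornerZ -!mulrBr.
move=> H; rewrite mulrBr subr_ge0; apply: H.
  by rewrite /theta divfK ?gt_eqF.
move=> x y xi yi.
have sx := inslot_between hc im xi; have sy := inslot_between hd im yi.
have xn j : (j < m)%N -> x != c j.
  by move=> /sx; case: ltnP => _ h; [rewrite gt_eqF|rewrite lt_eqF].
pose u := s * (m.+1%:R * (cprod c m).[x]); pose w := s * (m.+1%:R * (cprod d m).[y]).
have uE : (deriv (s *: critpoly c m)).[x] = u by rewrite derivZ deriv_critpoly !hornerZ.
have wE : (deriv (s *: critpoly d m)).[y] = w by rewrite derivZ deriv_critpoly !hornerZ.
have u0 : 0 < u by rewrite -uE dpos.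
have w0 : 0 < w by rewrite -wE dpos.
pose r j := (y - d j) / (x - c j).
have r0 j : (j < m)%N -> 0 < r j.
  move=> jm; have := sx j jm; have := sy j jm; rewrite /r; case: ltnP => _ yj xj.
    by rewrite divr_gt0 // subr_gt0.
  by rewrite -mulrNN -invrN divr_gt0 // opprB subr_gt0.
have rw : \prod_(j < m) r j * (theta * u / w) = theta.
  have -> : \prod_(j < m) r j = w / u.
    rewrite /r prodf_div -!horner_cprod /w /u !mulrA -mulf_div divff ?mul1r //.
    by rewrite mulf_neq0 ?signr_eq0 ?pnatr_eq0.
  by field; rewrite !gt_eqF.
pose e (j : 'I_m.+1) := if (j < m)%N then r j else theta * u / w.
have : m.+1%:R <= \sum_j e j.
  apply: sum_ge_prod1 => // [j|].
    rewrite /e; case: ifP => [/r0/ltW //|_].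
    have th0 := lt_le_trans ltr01 th1.
    by apply: divr_ge0; [apply: mulr_ge0|]; apply: ltW.
  rewrite big_ord_recr /= {2}/e /= ltnn.
  suff -> : \prod_(j < m) e (widen_ord (leqnSn m) j) = \prod_(j < m) r j.
    by rewrite rw.
  by apply: eq_bigr => j _; rewrite /e /= ltn_ord.
rewrite big_ord_recr /= {2}/e /= ltnn.
have -> : \sum_(j < m) e (widen_ord (leqnSn m) j) = \sum_(j < m) r j.
  by apply: eq_bigr => j _; rewrite /e /= ltn_ord.
move=> agm; rewrite uE wE derivZ hornerZ deriv_prim horner_variation //.
rewrite derivZ deriv_critpoly !derivZ !hornerZ horner_deriv_cprod //.
have -> : s * (- (m.+1%:R * (cprod c m).[x]) * \sum_(j < m) (d j - c j) / (x - c j)) +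
   s * (m.+1%:R * ((cprod c m).[x] * \sum_(j < m) (x - c j)^-1)) * (y - x) +
   u * (theta * u / w - 1) =
   u * (\sum_(j < m) (x - c j)^-1 * (y - x) - \sum_(j < m) (d j - c j) / (x - c j) +
      (theta * u / w - 1)).
  by rewrite -mulr_suml /u; ring.
rewrite mulr_ge0 ?(ltW u0) // -sumrB.
have -> : \sum_(j < m) ((x - c j)^-1 * (y - x) - (d j - c j) / (x - c j)) =
    \sum_(j < m) (r j - 1).
  by apply: eq_bigr => j _; rewrite /r; field; rewrite subr_eq0 xn.
rewrite sumrB sumr_const card_ord.
by move: agm; rewrite -natr1; lra.
Qed.

(** The zero sum of the velocities kills the coefficient of degree k + 1. In the next one, omitting
    the j-th factor leaves the sum of all points minus [c j], and the total again cancels. *)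
Lemma variation_coef c (xi : nat -> R) k : \sum_(j < k.+2) xi j = 0 ->
  (size (variation c xi k.+2) <= k.+1)%N /\
  (variation c xi k.+2)`_k = - (k.+3%:R * \sum_(j < k.+2) xi j * c j).
Proof.
move=> xi0; split.
  apply/leq_sizeP => l; rewrite leq_eqVlt => /predU1P[<-|kl].
    rewrite coefN coefZ coef_sum; under eq_bigr do rewrite coefZ cprod_lead mulr1.
    by rewrite xi0 mulr0 oppr0.
  rewrite coefN coefZ coef_sum big1 ?mulr0 ?oppr0 // => j _.
  by rewrite coefZ (nth_default _ _) ?mulr0 // size_cprod.
rewrite coefN coefZ coef_sum; congr (- (_ * _)).
have E j : (j < k.+2)%N ->
    (cprod (c \o bump j) k.+1)`_k = c j - \sum_(l < k.+2) c l.
  move=> jk; rewrite cprod_coef1 (bigD1_ord (Ordinal jk)) //=; ring.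
rewrite (eq_bigr (fun j : 'I_k.+2 => xi j * c j - xi j * \sum_(l < k.+2) c l)).
  by rewrite sumrB -mulr_suml xi0 mul0r subr0.
by move=> j _; rewrite coefZ E // mulrBr.
Qed.

(** By the mean value theorem the alternating increments give k + 1 intermediate points at which the
    derivative alternates; [lead_alt_le0] applies there. *)
Lemma lead_deriv_le0 c p k : inc c k.+2 -> (size (deriv p) <= k.+1)%N ->
  (forall i, (i < k.+1)%N -> 0 <= (-1) ^+ (k.+2 - i.+1) * (p.[c i.+1] - p.[c i])) ->
  (deriv p)`_k <= 0 /\
  ((deriv p)`_k = 0 -> forall i, (i < k.+1)%N -> p.[c i.+1] = p.[c i]).
Proof.
move=> hc sp hs.
have tex i : exists t, (i < k.+1)%N -> [/\ c i < t < c i.+1,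
    p.[c i.+1] - p.[c i] = (deriv p).[t] * (c i.+1 - c i) &
    (-1) ^+ (k - i) * (deriv p).[t] <= 0].
  case: (ltnP i k.+1) => [ik|]; last by exists 0.
  have cc : c i < c i.+1 by apply: hc.
  have [t /itvP tc /= e] := poly_mvt p cc.
  exists t => _; rewrite !tc; split=> //.
  have := hs i ik; rewrite e subSS subSn // exprS mulrA pmulr_lge0 ?subr_gt0 //; lra.
have /choice[t tP] := tex.
have ht : inc t k.+1.
  apply: inc_step => i ik; have [/andP[_ a] _ _] := tP i (ltnW ik).
  by have [/andP[b _] _ _] := tP i.+1 ik; apply: lt_trans b.
have [h1 h2] := lead_alt_le0 ht sp (fun i ik => let: And3 _ _ r := tP i ik in r).
split=> // /h2 h i ik; have [_ e _] := tP i ik.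
by move/eqP: e; rewrite h // mul0r subr_eq0 => /eqP.
Qed.

Lemma width_le_dot c d m : inc c m -> inc d m ->
  \sum_(j < m) c j = 0 -> \sum_(j < m) d j = 0 ->
  (forall i, (i.+1 < m)%N -> width c m i <= width d m i) ->
  \sum_(j < m) c j ^+ 2 <= \sum_(j < m) c j * d j.
Proof.
case: m => [|[|k]] hc hd c0 d0 wcd; first by rewrite !big_ord0.
  by move: c0; rewrite !big_ord1 => ->; rewrite expr0n mul0r.
pose xi j := d j - c j.
have xi0 : \sum_(j < k.+2) xi j = 0 by rewrite sumrB c0 d0 subrr.
have [sV VE] := variation_coef c xi0.
have := @lead_deriv_le0 c (prim (variation c xi k.+2)) k hc.
rewrite deriv_prim => /(_ sV)[i ik|]; first exact: variation_width (wcd i ik).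
rewrite VE oppr_le0 pmulr_rge0 ?ltr0n // => h _.
rewrite -subr_ge0 -sumrB; apply: le_trans h _.
by apply: ler_sum => j _; rewrite /xi; lra.
Qed.

End Width.

(** * Stability of the critical points in terms of the heights; location of roots *)

Section Stability.
Variable R : realType.
Implicit Types (c d s : nat -> R) (p q : {poly R}).

Lemma cprod_scale c m (r : R) :
  cprod (fun j => r * c j) m \Po (r *: 'X) = r ^+ m *: cprod c m.
Proof.
elim: m => [|m IH]; first by rewrite !cprod0 comp_polyC scale1r.
rewrite !cprodS comp_polyM IH comp_polyB comp_polyX comp_polyC.
have -> : r *: 'X - (r * c m)%:P = r *: ('X - (c m)%:P).
  by rewrite scalerBr -mul_polyC -[in RHS]mul_polyC polyCM mul_polyC.
by rewrite -scalerAl -scalerAr scalerA exprSr.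
Qed.

Lemma critpoly_scale c m (r x : R) :
  (critpoly (fun j => r * c j) m).[r * x] = r ^+ m.+1 * (critpoly c m).[x].
Proof.
have := @deriv_eq_horner R (critpoly (fun j => r * c j) m \Po (r *: 'X))
  (r ^+ m.+1 *: critpoly c m) _ x 0.
rewrite !horner_comp !hornerZ !hornerX mulr0 !critpoly0 mulr0 !subr0; apply.
rewrite deriv_comp !deriv_critpoly derivZ derivX comp_polyZ cprod_scale derivZ.
rewrite deriv_critpoly alg_polyC mulrC mul_polyC !scalerA; congr (_ *: _).
by rewrite exprS; ring.
Qed.

Lemma width_scale c m i (r : R) :
  width (fun j => r * c j) m i = r ^+ m.+1 * width c m i.
Proof. by rewrite /width !critpoly_scale; ring. Qed.

(** Applying [width_le_dot] to c and r d, then to d and r c, gives |c|^2 <= r <c, d> and |d|^2 <= r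
    <c, d>. With Cauchy-Schwarz this yields |d| <= r |c|, and the factor obtained for |d - c|^2
    tends to 0 as r tends to 1. *)
Lemma dot_stable c d m (r : R) : 1 <= r -> inc c m -> inc d m ->
  \sum_(j < m) c j = 0 -> \sum_(j < m) d j = 0 ->
  (forall i, (i.+1 < m)%N -> width c m i <= r ^+ m.+1 * width d m i) ->
  (forall i, (i.+1 < m)%N -> width d m i <= r ^+ m.+1 * width c m i) ->
  \sum_(j < m) (d j - c j) ^+ 2 <= (r ^+ 2 + 1 - 2 / r) * \sum_(j < m) c j ^+ 2.
Proof.
move=> r1 hc hd c0 d0 wc wd.
have r0 : 0 < r := lt_le_trans ltr01 r1.
have hr e : inc e m -> inc (fun j => r * e j) m.
  by move=> he i j ij jm; rewrite ltr_pM2l // he.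
have sr e : \sum_(j < m) e j = 0 -> \sum_(j < m) r * e j = 0 :> R.
  by rewrite -mulr_sumr => ->; rewrite mulr0.
have := width_le_dot hc (hr _ hd) c0 (sr _ d0) _.
have := width_le_dot hd (hr _ hc) d0 (sr _ c0) _.
set C := \sum_(j < m) c j ^+ 2; set D := \sum_(j < m) d j ^+ 2.
pose X := \sum_(j < m) c j * d j.
have -> : \sum_(j < m) c j * (r * d j) = r * X.
  by rewrite mulr_sumr; apply: eq_bigr => j _; ring.
have -> : \sum_(j < m) d j * (r * c j) = r * X.
  by rewrite mulr_sumr; apply: eq_bigr => j _; ring.
have -> : \sum_(j < m) (d j - c j) ^+ 2 = D - 2 * X + C.
  rewrite /D /X /C mulr_sumr -sumrB -big_split /=; apply: eq_bigr => j _; ring.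
move=> h1 h2.
have {}h1 : D <= r * X by apply: h1 => i im; rewrite width_scale wd.
have {}h2 : C <= r * X by apply: h2 => i im; rewrite width_scale wc.
have D0 : 0 <= D by apply: sumr_ge0 => j _; rewrite sqr_ge0.
have C0 : 0 <= C by apply: sumr_ge0 => j _; rewrite sqr_ge0.
(* Cauchy-Schwarz through 0 <= |d - r c|^2 *)
have cs : 2 * r * X <= D + r ^+ 2 * C.
  rewrite -subr_ge0.
  have -> : D + r ^+ 2 * C - 2 * r * X = \sum_(j < m) (d j - r * c j) ^+ 2.
    rewrite /D /X /C !mulr_sumr -big_split -sumrB /=; apply: eq_bigr => j _; ring.
  by apply: sumr_ge0 => j _; rewrite sqr_ge0.
have DC : D <= r ^+ 2 * C by lra.
have XC : C / r <= X by rewrite ler_pdivrMr // mulrC.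
have -> : (r ^+ 2 + 1 - 2 / r) * C = r ^+ 2 * C + C - 2 * (C / r) by field; lra.
lra.
Qed.

(** The case r = 1 of [dot_stable], where the factor vanishes. *)
Lemma width_inj c d m : inc c m -> inc d m ->
  \sum_(j < m) c j = 0 -> \sum_(j < m) d j = 0 ->
  (forall i, (i.+1 < m)%N -> width c m i = width d m i) ->
  forall j, (j < m)%N -> c j = d j.
Proof.
move=> hc hd c0 d0 wcd j jm.
have := dot_stable (lexx 1) hc hd c0 d0.
have -> : (1 ^+ 2 + 1 - 2 / 1 : R) = 0 by rewrite expr1n divr1; ring.
rewrite mul0r.
move=> h; have {}h : \sum_(j < m) (d j - c j) ^+ 2 <= 0.
  by apply: h => i im; rewrite expr1n mul1r (wcd _ im).
have : \sum_(j < m) (d j - c j) ^+ 2 == 0.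
  by rewrite eq_le h sumr_ge0 // => i _; rewrite sqr_ge0.
rewrite psumr_eq0 => [|i _]; last exact: sqr_ge0.
move=> /allP/(_ (Ordinal jm) (mem_index_enum _)) /=.
by rewrite sqrf_eq0 subr_eq0 => /eqP.
Qed.

(** One root in each of [m] disjoint windows exhausts the degree. *)
Lemma roots_in_windows (al be : nat -> R) p m :
  (forall i, (i < m)%N -> al i < be i) ->
  (forall i, (i.+1 < m)%N -> be i <= al i.+1) ->
  p \is monic -> size p = m.+1 ->
  (forall i, (i < m)%N -> p.[al i] * p.[be i] < 0) ->
  exists2 c, (forall i, (i < m)%N -> al i < c i < be i) & p = cprod c m.
Proof.
move=> ab ba mp sp hp.
have ex i : exists x, (i < m)%N -> al i < x < be i /\ root p x.
  case: (ltnP i m) => [im|]; last by exists 0.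
  have [x /itvP xs rx] := poly_ivtoo (ltW (ab i im)) (hp i im).
  by exists x => _; rewrite !xs.
have /choice[c cP] := ex.
exists c => [i im|]; first by have [] := cP i im.
have hc : inc c m.
  apply: inc_step => i im; have [/andP[_ a] _] := cP i (ltnW im).
  by have [/andP[b _] _] := cP i.+1 im; apply: lt_trans b; apply: lt_le_trans a (ba i im).
have := @all_roots_prod_XsubC _ p [seq c i | i <- iota 0 m].
rewrite size_map size_iota -cprod_seq => /(_ sp).
rewrite (monicP mp) scale1r; apply.
- by apply/allP => x /mapP[i]; rewrite mem_iota add0n => /andP[_ /cP[_ ?]] ->.
- rewrite uniq_rootsE map_inj_in_uniq ?iota_uniq // => i j.
  rewrite !mem_iota !add0n /= => im jm e.
  by have [ij|ji|//] := ltngtP i j; [have := hc _ _ ij jm|have := hc _ _ ji im];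
    rewrite e ltxx.
Qed.

Lemma sign_change (x y : R) m i : (i < m)%N -> 0 < (-1) ^+ (m - i) * x ->
  0 < (-1) ^+ (m - i.+1) * y -> x * y < 0.
Proof.
move=> im hx hy; have := mulr_gt0 hx hy; rewrite -(subnSK im) exprS.
have -> : -1 * (-1) ^+ (m - i.+1) * x * ((-1) ^+ (m - i.+1) * y)
  = - ((-1) ^+ (m - i.+1)) ^+ 2 * (x * y) by ring.
by rewrite sqrr_sign mulN1r oppr_gt0.
Qed.

(** A critical point is extremal on the whole interval between its neighbours. Applied to a
    perturbed polynomial at the old critical points, this shows that passing to the new ones can
    only increase a height. *)
Lemma crit_extremal c m i x : inc c m -> (i < m)%N ->
  (forall j, (j < i)%N -> c j <= x) -> (forall j, (i < j < m)%N -> x <= c j) ->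
  0 <= (-1) ^+ (m - i) * ((critpoly c m).[c i] - (critpoly c m).[x]).
Proof.
move=> hc im xl xr; have [xc|cx|->] := ltgtP x (c i); last by rewrite subrr mulr0.
  apply/ltW/critpoly_mono => // z /andP[xz zc] j jm; case: ltnP => ij.
    exact: le_lt_trans (xl _ ij) xz.
  exact: lt_le_trans zc (inc_le hc ij jm).
have := @critpoly_mono R c m i.+1 _ _ cx.
rewrite -(subnSK im) exprS => h; apply/ltW.
suff : 0 < (-1) ^+ (m - i.+1) * ((critpoly c m).[x] - (critpoly c m).[c i]) by lra.
apply: h => z /andP[cz zx] j jm; case: ltnP => ij.
  by apply: le_lt_trans cz; apply: inc_le hc _ _.
by apply: lt_le_trans zx _; apply: xr; rewrite ij.
Qed.

Lemma small_pos n (al be : nat -> R) : (forall i, (i < n)%N -> 0 < al i) ->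
  exists2 t0, 0 < t0 & forall t, 0 < t <= t0 -> forall i, (i < n)%N ->
    0 < al i + t * be i.
Proof.
elim: n => [|n IH] h; first by exists 1.
have [|t0 t00 ht] := IH; first by move=> i im; apply: h; apply: ltnW.
have an := h n (ltnSn n).
have b0 : 0 < `|be n| + 1 by rewrite ltr_wpDl.
exists (Num.min t0 (al n / (`|be n| + 1))).
  by rewrite lt_min t00 divr_gt0.
move=> t /andP[tp]; rewrite le_min => /andP[tt0 ta] i.
rewrite ltnS leq_eqVlt => /predU1P[->|]; last by apply: ht; rewrite tp.
move: ta; rewrite ler_pdivlMr // mulrDr mulr1 => ta.
have : - (t * `|be n|) <= t * be n by rewrite -mulrN ler_pM2l // lerNl -normrN ler_norm.
lra.
Qed.

End Stability.

(** * Decreasing the norm when a height has slack *)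

Section ShrinkSpread.
Variable R : realType.
Implicit Types (c d s : nat -> R) (p q : {poly R}).

(** Values to be interpolated at the critical points: adding t times the interpolant changes the
    i-th height, measured at the old critical points, by t [e i]. *)
Definition zigzag m (e : nat -> R) i : R := \sum_(l < i) (-1) ^+ (m - l.+1) * e l.

Lemma zigzag_step c m (e : nat -> R) i : inc c m -> (i.+1 < m)%N ->
  let p := interp c m (zigzag m e) in p.[c i.+1] - p.[c i] = (-1) ^+ (m - i.+1) * e i.
Proof.
move=> hc im /=; rewrite !horner_interp ?(ltnW im) //.
by rewrite /zigzag big_ord_recr /=; ring.
Qed.

Lemma zigzag_lead c k (e : nat -> R) i : inc c k.+2 ->
  (forall l, (l < k.+1)%N -> 0 <= e l) -> (i < k.+1)%N -> 0 < e i ->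
  (deriv (interp c k.+2 (zigzag k.+2 e)))`_k < 0.
Proof.
move=> hc e0 ik ei; set p := interp _ _ _.
have st l : (l < k.+1)%N -> p.[c l.+1] - p.[c l] = (-1) ^+ (k.+2 - l.+1) * e l.
  by move=> lk; apply: (@zigzag_step c k.+2 e l hc).
have [||h1 h2] := @lead_deriv_le0 R c p k hc.
- have [->|pn] := eqVneq p 0; first by rewrite deriv0 size_poly0.
  by have := lt_size_deriv pn; have := size_interp c k.+2 (zigzag k.+2 e); rewrite -/p; lia.
- by move=> l lk; rewrite st // mulrA -expr2 sqrr_sign mul1r e0.
rewrite lt_neqAle h1 andbT; apply/eqP => /h2/(_ i ik) h.
have := st i ik; rewrite h subrr => /esym/eqP.
by rewrite mulf_eq0 signr_eq0 /= gt_eqF.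
Qed.

(* If a width exceeds its lower bound, moving the critical values (rather than
   the critical points) decreases the spread: local maxima move up and local
   minima move down at least as fast as the values at the old critical points. *)
Lemma shrink_spread c (a : nat -> R) k j : inc c k.+2 -> \sum_(i < k.+2) c i = 0 ->
  (forall i, (i < k.+1)%N -> a i <= width c k.+2 i) -> (j < k.+1)%N ->
  a j < width c k.+2 j ->
  exists d, [/\ inc d k.+2, \sum_(i < k.+2) d i = 0,
    forall i, (i < k.+1)%N -> a i <= width d k.+2 i &
    \sum_(i < k.+2) d i ^+ 2 < \sum_(i < k.+2) c i ^+ 2].
Proof.
move=> hc c0 wc jk aj; set m := k.+2.
pose G1 := interp c m (zigzag m (fun=> 1)).
pose G2 := interp c m (zigzag m (fun i => (i == j)%:R)).
have L1 : (deriv G1)`_k < 0 by apply: (@zigzag_lead c k (fun=> 1) j).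
have L2 : (deriv G2)`_k < 0.
  by apply: (@zigzag_lead c k (fun i => (i == j)%:R) j) => //; rewrite ?eqxx ?ler0n.
(* Adding [D] raises every height by [eps] and lowers the j-th by 1. This [eps] leaves the
   coefficient of degree k of the derivative of [D] at minus half that of [G2], hence positive. *)
pose eps := (deriv G2)`_k / (2 * (deriv G1)`_k).
have eps0 : 0 < eps by rewrite /eps -mulrNN -invrN divr_gt0 //; lra.
pose D := eps *: G1 - G2.
have sD : (size D <= m)%N.
  rewrite (leq_trans (size_polyD _ _)) // size_polyN geq_max size_interp andbT.
  exact: leq_trans (size_scale_leq _ _) (size_interp _ _ _).
have DS i : (i < k.+1)%N ->
    D.[c i.+1] - D.[c i] = (-1) ^+ (m - i.+1) * (eps - (i == j)%:R).
  move=> ik; rewrite /D !hornerE.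
  have := @zigzag_step c m (fun=> 1) i hc ik.
  have := @zigzag_step c m (fun i => (i == j)%:R) i hc ik.
  rewrite -/G1 -/G2 /= mulr1 => e2 e1.
  have -> : eps * G1.[c i.+1] - G2.[c i.+1] - (eps * G1.[c i] - G2.[c i]) =
    eps * (G1.[c i.+1] - G1.[c i]) - (G2.[c i.+1] - G2.[c i]) by ring.
  by rewrite e1 e2; ring.
have LD : 0 < (deriv D)`_k.
  have -> : (deriv D)`_k = - (deriv G2)`_k / 2.
    by rewrite derivB derivZ coefB coefZ /eps; field; rewrite lt_eqF.
  by rewrite divr_gt0 // oppr_gt0.
(* Sample points interlacing [c], with one beyond each end: the signs there survive a small
   perturbation and frame the new roots. *)
pose s i := if i == 0%N then c 0%N - 1 else
  if (i < m)%N then (c i.-1 + c i) / 2 else c i.-1 + 1.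
have sl i : (i < m)%N -> s i < c i.
  rewrite /s; case: i => [|i] /= im; first by lra.
  by rewrite im; have := hc i i.+1 (ltnSn i) im; lra.
have sr i : (i < m)%N -> c i < s i.+1.
  rewrite /s /=; case: ifP => im _; last by lra.
  by have := hc i i.+1 (ltnSn i) im; lra.
have hs : inc s m.+1.
  by apply: inc_step => i im; apply: lt_trans (sl i im) (sr i im).
have ss i : (i <= m)%N -> inslot c m i (s i).
  move=> im l lm; case: ltnP => il.
    case: i il im => // i; rewrite ltnS => li im.
    exact: le_lt_trans (inc_le hc li im) (sr i im).
  exact: lt_le_trans (sl i (leq_ltn_trans il lm)) (inc_le hc il lm).
have m10 : 0 < m.+1%:R :> R by rewrite ltr0n.
have [//|t1 t10 ht1] := @small_pos R m.+1
  (fun i => (-1) ^+ (m - i) * (cprod c m).[s i])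
  (fun i => (-1) ^+ (m - i) * ((deriv D).[s i] / m.+1%:R)) .
  by move=> i im; apply/cprod_slot_sign/ss.
(* The j-th height changes by t (eps - 1), so this bound keeps it above [a j]; the slack itself
   works because eps is positive. *)
have [t2 t20 ht2] : exists2 t2, 0 < t2 & t2 * (1 - eps) <= width c m j - a j.
  exists (width c m j - a j); first by rewrite subr_gt0.
  rewrite ler_piMr //; first by rewrite subr_ge0 ltW.
  lra.
pose t := Num.min t1 t2.
have t0 : 0 < t by rewrite lt_min t10.
have ht : forall i, (i < m.+1)%N -> 0 < (-1) ^+ (m - i) * (cprod c m).[s i] +
    t * ((-1) ^+ (m - i) * ((deriv D).[s i] / m.+1%:R)).
  by apply: ht1; rewrite t0 ge_min lexx.
(* [P] is the derivative of [critpoly c m + t *: D] divided by m + 1. The added term has degree at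
   most m - 2, so the sum of the roots stays zero. *)
pose P := cprod c m + (t / m.+1%:R) *: deriv D.
have sdD : (size (deriv D) < m)%N.
  have [->|Dn] := eqVneq D 0; first by rewrite deriv0 size_poly0.
  exact: leq_trans (lt_size_deriv Dn) sD.
have sP : size P = m.+1.
  rewrite size_polyDl size_cprod // (leq_ltn_trans (size_scale_leq _ _)) //.
  exact: ltn_trans sdD _.
have mP : P \is monic.
  apply/monicP; rewrite lead_coefE sP /= coefD cprod_lead coefZ (nth_default _ (ltnW sdD)).
  by rewrite mulr0 addr0.
have Ps i : (i <= m)%N -> 0 < (-1) ^+ (m - i) * P.[s i].
  by move=> im; have := ht i im; rewrite /P hornerD hornerZ; congr (0 < _); ring.
have [i im|i im||d dw Pd] := @roots_in_windows R s (s \o S) P m _ _ mP sP.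
- exact: hs.
- exact: lexx.
- by move=> i im; apply: sign_change (Ps i (ltnW im)) (Ps i.+1 im).
have hd : inc d m.
  apply: inc_step => i im; have /andP[_ a1] := dw i (ltnW im).
  by have /andP[b _] := dw i.+1 im; apply: lt_trans b.
have dE : deriv (critpoly d m) = deriv (critpoly c m + t *: D).
  rewrite derivD derivZ !deriv_critpoly -Pd /P scalerDr scalerA; congr (_ + _ *: _).
  by field; rewrite gt_eqF.
have d0 : \sum_(i < k.+2) d i = 0.
  have := congr1 (fun q : {poly R} => q`_k.+1) Pd.
  rewrite /= cprod_coef1 coefD coefZ cprod_coef1 c0 (nth_default _ (sdD : (_ <= k.+1)%N)).
  by rewrite mulr0 addr0 oppr0 => /esym/eqP; rewrite oppr_eq0 => /eqP.
exists d; split => //.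
- move=> i ik; apply: (@le_trans _ _ (width c m i + t * (eps - (i == j)%:R))).
    case: eqP => [->|_]; last by rewrite subr0 (le_trans (wc i ik)) // lerDl mulr_ge0 // ltW.
    have tt2 : t <= t2 by rewrite ge_min lexx orbT.
    rewrite mulr1n; have [e1|e1] := leP eps 1.
      have := ler_wpM2r (_ : 0 <= 1 - eps) tt2; rewrite subr_ge0 => /(_ e1).
      by move: ht2; lra.
    have : 0 <= t * (eps - 1) by apply: mulr_ge0; rewrite ?subr_ge0; apply: ltW.
    by move: aj; lra.
  have im : (i < m)%N := ltnW (ik : (i.+1 < m)%N).
  have e1 := crit_extremal hd (ik : (i.+1 < m)%N) (x := c i.+1).
  have e2 := crit_extremal hd im (x := c i).
  have {}e1 : 0 <= (-1) ^+ (m - i.+1) * ((critpoly d m).[d i.+1] - (critpoly d m).[c i.+1]).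
    apply: e1 => [l li|l /andP[il lm]].
      have /andP[_ /ltW h] := dw l (leq_trans li im).
      apply: le_trans h (le_trans (inc_le hs li _) (ltW (sl i.+1 ik))) => //.
    have /andP[/ltW h _] := dw l lm.
    exact: le_trans (le_trans (ltW (sr i.+1 ik)) (inc_le hs il (leqW lm))) h.
  have {}e2 : 0 <= (-1) ^+ (m - i) * ((critpoly d m).[d i] - (critpoly d m).[c i]).
    apply: e2 => [l li|l /andP[il lm]].
      have /andP[_ /ltW h] := dw l (ltn_trans li im).
      apply: le_trans h (le_trans (inc_le hs li _) (ltW (sl i im))) => //.
      exact: leqW.
    have /andP[/ltW h _] := dw l lm.
    exact: le_trans (le_trans (ltW (sr i im)) (inc_le hs il (leqW lm))) h.
  move: e2; rewrite -(subnSK im) exprS => e2.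
  have := deriv_eq_horner dE (c i.+1) (c i); rewrite !hornerD !hornerZ => e3.
  have e4 := DS i ik; rewrite /width.
  set sg : R := (-1) ^+ (m - i.+1) in e1 e2 e4 *.
  have sg2 : sg * sg = 1 by rewrite -expr2 sqrr_sign.
  have : sg * ((critpoly d m).[c i.+1] - (critpoly d m).[c i]) =
    sg * ((critpoly c m).[c i.+1] - (critpoly c m).[c i]) + t * (eps - (i == j)%:R).
    rewrite e3.
    have -> : (critpoly c m).[c i.+1] + t * D.[c i.+1] - ((critpoly c m).[c i] + t * D.[c i])
     = (critpoly c m).[c i.+1] - (critpoly c m).[c i] + t * (D.[c i.+1] - D.[c i]) by ring.
    have -> : t * (eps - (i == j)%:R) = (sg * sg) * (t * (eps - (i == j)%:R)).
      by rewrite sg2 mul1r.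
    by rewrite e4; ring.
  by move: e1 e2; lra.
(* On both sides the coefficient of degree k is minus half a sum of squares, and the perturbation
   has increased it. *)
- have := congr1 (fun q : {poly R} => q`_k) Pd.
  rewrite /= cprod_coef2 coefD coefZ cprod_coef2 c0 d0.
  have : 0 < t / m.+1%:R * (deriv D)`_k by rewrite mulr_gt0 // divr_gt0.
  move=> h; rewrite -/m expr0n /= sub0r => e; move: h e; set X := t / _ * _; lra.
Qed.

End ShrinkSpread.

(** * Continuity of values and heights in the critical points *)

Section Continuity.
Variables (R : realType) (T : Type) (F : set_system T).
Context {FF : Filter F}.
Implicit Types (c : T -> nat -> R) (d : nat -> R).

Lemma cvg_ord_sum n (f : 'I_n -> T -> R) (l : 'I_n -> R) :
  (forall i, f i t @[t --> F] --> l i) ->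
  \sum_i f i t @[t --> F] --> \sum_i l i.
Proof. by move=> h; apply: cvg_big => // x; exact: add_continuous. Qed.

Lemma cvg_cprod_coef c d m i :
  (forall j, (j < m)%N -> c t j @[t --> F] --> d j) ->
  (cprod (c t) m)`_i @[t --> F] --> (cprod d m)`_i.
Proof.
elim: m i => [|m IH] i h.
  by under eq_fun do rewrite cprod0; rewrite cprod0; exact: cvg_cst.
under eq_fun do rewrite cprodS mulrBr coefB coefMX coefMC.
rewrite cprodS mulrBr coefB coefMX coefMC.
have IH' k := IH k (fun j jm => h j (ltnW jm)).
apply: cvgB; first by case: i => [|i] /=; [exact: cvg_cst | exact: IH'].
by apply: cvgM; [exact: IH' | exact: h].
Qed.

Lemma critpoly_coef d m i : (critpoly d m)`_i =
  if (i < m.+2)%N then m.+1%:R * (cprod d m)`_i.-1 / i%:R else 0.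
Proof. by rewrite coef_poly coefZ size_scale ?pnatr_eq0 // size_cprod. Qed.

Lemma size_critpoly d m : (size (critpoly d m) <= m.+2)%N.
Proof.
by apply/leq_sizeP => i mi; rewrite critpoly_coef ltnNge mi.
Qed.

Lemma cvg_critpoly_coef c d m i :
  (forall j, (j < m)%N -> c t j @[t --> F] --> d j) ->
  (critpoly (c t) m)`_i @[t --> F] --> (critpoly d m)`_i.
Proof.
move=> h; under eq_fun do rewrite critpoly_coef; rewrite critpoly_coef.
case: ifP => _; last exact: cvg_cst.
by apply: cvgMl; apply: cvgMr; exact: cvg_cprod_coef.
Qed.

Lemma cvg_horner (p : T -> {poly R}) (q : {poly R}) n (x : T -> R) (y : R) :
  (forall t, (size (p t) <= n)%N) -> (size q <= n)%N ->
  (forall i, (i < n)%N -> (p t)`_i @[t --> F] --> q`_i) ->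
  x t @[t --> F] --> y -> (p t).[x t] @[t --> F] --> q.[y].
Proof.
move=> sp sq pq xy.
under eq_fun do rewrite (horner_coef_wide _ (sp _)).
rewrite (horner_coef_wide _ sq); apply: cvg_ord_sum => i.
apply: cvgM; first exact: pq.
elim: {i} (i : nat) => [|i IH]; first by under eq_fun do rewrite expr0; exact: cvg_cst.
by under eq_fun do rewrite exprS; rewrite exprS; exact: cvgM.
Qed.

Lemma cvg_critpoly c d m (x : T -> R) (y : R) :
  (forall j, (j < m)%N -> c t j @[t --> F] --> d j) ->
  x t @[t --> F] --> y ->
  (critpoly (c t) m).[x t] @[t --> F] --> (critpoly d m).[y].
Proof.
move=> h; apply: (@cvg_horner _ _ m.+2) => [t||i _]; rewrite ?size_critpoly //.
exact: cvg_critpoly_coef.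
Qed.

Lemma cvg_width c d m i : (i.+1 < m)%N ->
  (forall j, (j < m)%N -> c t j @[t --> F] --> d j) ->
  width (c t) m i @[t --> F] --> width d m i.
Proof.
move=> im h; apply: cvgMr; apply: cvgB; apply: cvg_critpoly => //; apply: h => //.
exact: ltnW.
Qed.

End Continuity.

(** * The heights as coordinates: surjectivity and continuity of the inverse *)

Section WidthBijection.
Variable R : realType.
Implicit Types (c : nat -> R).

(** Equally spaced centred points, dilated by some [r] at least 1: the heights grow by r^(m+1),
    hence at least by [r]. *)
Lemma exists_inc_big_width (a : nat -> R) m :
  exists c, [/\ inc c m, \sum_(j < m) c j = 0 &
    forall i, (i.+1 < m)%N -> a i <= width c m i].
Proof.
pose mu : R := (\sum_(j < m) j%:R) / m%:R.
pose c j : R := j%:R - mu.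
have hc : inc c m by move=> i j ij _; rewrite ltrD2r ltr_nat.
have c0 : \sum_(j < m) c j = 0.
  rewrite sumrB sumr_const card_ord -mulr_natr /mu.
  have [m0|m0] := posnP m; first by rewrite m0 !big_ord0 !mul0r subrr.
  by rewrite divfK ?subrr // pnatr_eq0 -lt0n.
pose r : R := 1 + \sum_(i < m | (i.+1 < m)%N) `|a i| / width c m i.
have tp i : (i.+1 < m)%N -> 0 <= `|a i| / width c m i.
  by move=> im; rewrite divr_ge0 // ltW // width_gt0.
have r1 : 1 <= r by rewrite lerDl sumr_ge0 // => i /tp.
have r0 : 0 < r := lt_le_trans ltr01 r1.
exists (fun j => r * c j); split.
- by move=> i j ij jm; rewrite ltr_pM2l // hc.
- by rewrite -mulr_sumr c0 mulr0.
move=> i im; rewrite width_scale -ler_pdivrMr ?width_gt0 //.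
apply: (@le_trans _ _ (`|a i| / width c m i)).
  by rewrite ler_pM2r ?ler_norm // invr_gt0 width_gt0.
apply: (@le_trans _ _ r); last by rewrite ler_eXnr.
rewrite /r (bigD1 (Ordinal (ltnW im))) //= addrCA lerDl addr_ge0 //.
by apply: sumr_ge0 => j /andP[/tp].
Qed.

Lemma exists_width (a : nat -> R) m : (forall i, (i.+1 < m)%N -> 0 < a i) ->
  exists c, [/\ inc c m, \sum_(j < m) c j = 0 &
    forall i, (i.+1 < m)%N -> width c m i = a i].
Proof.
case: m => [|[|k]] a0.
- by exists (fun=> 0); split; rewrite ?big_ord0 // => i j; lia.
- by exists (fun=> 0); split; rewrite ?big_ord1 // => i j; lia.
set m := k.+2 in a0 *.
have [c0 [hc0 sc0 wc0]] := exists_inc_big_width a m.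
pose Q (c : nat -> R) := \sum_(j < m) c j ^+ 2.
pose cf (M : 'rV[R]_m) (j : nat) := M 0 (inord j).
pose mk (c : nat -> R) : 'rV[R]_m := \row_j c j.
have mkK c j : (j < m)%N -> cf (mk c) j = c j.
  by move=> jm; rewrite /cf mxE inordK.
have cvgcf (M : 'rV[R]_m) j : cf N j @[N --> M] --> cf M j.
  exact: coord_continuous.
(* Monotonicity is relaxed to weak inequalities to make the set closed; the bound on [Q] makes it
   compact. *)
pose A := (\bigcap_(i in [set i | (i < k.+1)%N])
    ([set M | 0 <= cf M i.+1 - cf M i] `&` [set M | a i <= width (cf M) m i]))
  `&` ([set M | \sum_(j < m) cf M j = 0] `&` [set M | Q (cf M) <= Q c0]).
have Acl : closed A.
  have cl (f : 'rV[R]_m -> R) (D : set R) : (forall M, f N @[N --> M] --> f M) ->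
      closed D -> closed (f @^-1` D).
    by move=> cf' cD; apply: (continuous_closedP f).1.
  apply: closedI; last apply: closedI.
  - apply: closed_bigI => i /= ik; apply: closedI.
      apply: (cl (fun M => cf M i.+1 - cf M i) [set x | 0 <= x]) => [M|].
        exact: (cvgB (cvgcf M i.+1) (cvgcf M i)).
      exact: closed_ge.
    apply: (cl (fun M => width (cf M) m i) [set x | a i <= x]) => [M|].
      by apply: (@cvg_width _ _ (nbhs M)) => [|j _]; [exact: ik | exact: cvgcf].
    exact: closed_ge.
  - apply: (cl (fun M => \sum_(j < m) cf M j) [set x | x = 0]) => [M|].
      by apply: (@cvg_ord_sum _ _ (nbhs M)) => j; exact: cvgcf.
    exact: closed_eq.
  - apply: (cl (fun M => Q (cf M)) [set x | x <= Q c0]) => [M|].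
      apply: (@cvg_ord_sum _ _ (nbhs M)) => j.
      exact: (cvgM (cvgcf M j) (cvgcf M j)).
    exact: closed_le.
have Aco : compact A.
  have cB : compact [set M : 'rV[R]_m | forall i, `[- (Q c0 + 1), Q c0 + 1]%classic (M 0 i)].
    by apply: (@rV_compact _ m (fun=> `[- (Q c0 + 1), Q c0 + 1]%classic)) => _;
      exact: segment_compact.
  apply: (subclosed_compact Acl cB).
  move=> M [_ [_ QM]] i /=; rewrite in_itv /= -ler_norml.
  have le1 : (M 0 i) ^+ 2 <= Q c0.
    apply: le_trans QM; rewrite /Q (bigD1 i) //= /cf inord_val lerDl.
    by apply: sumr_ge0 => j _; rewrite sqr_ge0.
  rewrite -real_normK ?num_real // in le1.
  by have := normr_ge0 (M 0 i); nra.
have inA c : inc c m -> \sum_(j < m) c j = 0 ->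
    (forall i, (i.+1 < m)%N -> a i <= width c m i) -> Q c <= Q c0 -> A (mk c).
  move=> hc sc wc Qc; split; [move=> i /= ik; split|split] => /=.
  - by rewrite !mkK ?subr_ge0 //; [exact/ltW/hc | exact: ltnW].
  - rewrite /width (eq_critpoly (d := c)) ?mkK //; [exact: wc | exact: ltnW | exact: mkK].
  - by rewrite -[RHS]sc; apply: eq_bigr => j _; rewrite mkK.
  - by rewrite /Q; under eq_bigr do rewrite mkK //.
have [||M] := @EVT_min_rV R m (fun M => Q (cf M)) A _ Aco.
- by exists (mk c0); apply: inA.
- apply: continuous_subspaceT => M; apply: (@cvg_ord_sum _ _ (nbhs M)) => j.
  exact: (cvgM (cvgcf M j) (cvgcf M j)).
move=> /set_mem[hM [sM QM]] Mmin; pose c := cf M.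
(* Equal neighbours would give height 0, against the positive lower bound. *)
have hc : inc c m.
  apply: inc_step => i im; have [/= h1 h2] := hM i im.
  rewrite lt_neqAle -subr_ge0 h1 andbT; apply/eqP => e.
  have := lt_le_trans (a0 i im) h2; rewrite /width -/c e subrr mulr0.
  by rewrite ltxx.
exists c; split => // j jk; apply/eqP; rewrite eq_le (hM j jk).2 andbT.
rewrite leNgt; apply/negP => aj.
have [|d [hd sd wd Qd]] := shrink_spread hc sM _ jk aj.
  by move=> i ik; exact: (hM i ik).2.
have : mk d \in A.
  by apply/mem_set/inA => //; apply: le_trans QM; exact: ltW.
move=> /Mmin; rewrite leNgt => /negP; apply.
by apply: le_lt_trans Qd; rewrite /Q; under eq_bigr do rewrite mkK //.
Qed.

Lemma cvg_width_inv (T : Type) (F : set_system T) (FF : Filter F)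
    (c : T -> nat -> R) (d : nat -> R) m :
  inc d m -> \sum_(j < m) d j = 0 ->
  (\forall t \near F, inc (c t) m /\ \sum_(j < m) c t j = 0) ->
  (forall i, (i.+1 < m)%N -> width (c t) m i @[t --> F] --> width d m i) ->
  forall j, (j < m)%N -> c t j @[t --> F] --> d j.
Proof.
move=> hd sd hc wc j jm; apply/cvgrPdist_lt => e e0.
set Q := \sum_(j < m) d j ^+ 2.
have Q0 : 0 <= Q by apply: sumr_ge0 => i _; rewrite sqr_ge0.
have [r r1 rQ] : exists2 r, 1 < r & (r ^+ 2 + 1 - 2 / r) * Q < e ^+ 2.
  (* For r = 1 + h with h <= 1, the bound 1/r >= 1 - h gives r^2 + 1 - 2/r <= 4h + h^2 <= 5h; the 6
     and Q + 1 leave room for strictness. *)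
  pose h : R := Num.min 1 (e ^+ 2 / (6 * (Q + 1))).
  have h0 : 0 < h by rewrite lt_min ltr01 divr_gt0 ?exprn_gt0 //; lra.
  have h1 : h <= 1 by rewrite ge_min lexx.
  have h2 : h * (6 * (Q + 1)) <= e ^+ 2.
    by rewrite -ler_pdivlMr ?ge_min ?lexx ?orbT //; lra.
  exists (1 + h); first lra.
  have inv : 1 - h <= (1 + h)^-1 by rewrite -[leRHS]mul1r ler_pdivlMr; nra.
  by nra.
have r0 : 0 < r by lra.
have rm : 1 < r ^+ m.+1 by rewrite exprn_egt1.
have wnear n : \forall t \near F, forall i, (i < n)%N -> (i.+1 < m)%N ->
    width d m i < r ^+ m.+1 * width (c t) m i /\ width (c t) m i < r ^+ m.+1 * width d m i.
  elim: n => [|k IH]; first by near=> t.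
  have Hk : \forall t \near F, (k.+1 < m)%N ->
      width d m k < r ^+ m.+1 * width (c t) m k /\ width (c t) m k < r ^+ m.+1 * width d m k.
    have [km|nkm] := boolP (k.+1 < m)%N; last by apply: nearW.
    have w0 := width_gt0 hd km.
    have a1 : \forall t \near F, width (c t) m k < r ^+ m.+1 * width d m k.
      by apply: (@cvgr_lt _ _ F FF _ _ (wc k km)); rewrite ltr_pMl.
    have a2 : \forall t \near F, width d m k / r ^+ m.+1 < width (c t) m k.
      by apply: (@cvgr_gt _ _ F FF _ _ (wc k km)); rewrite gtr_pMr // invf_lt1 // exprn_gt0.
    near=> t => _; split; last by near: t.
    by rewrite mulrC -ltr_pdivrMr ?exprn_gt0 //; near: t.
  near=> t => i; rewrite ltnS leq_eqVlt => /predU1P[->|ik] im.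
    by move: im; near: t.
  by move: i ik im; near: t.
near=> t.
have [hct sct] : inc (c t) m /\ \sum_(j < m) c t j = 0 by near: t.
have wt : forall i, (i < m)%N -> (i.+1 < m)%N ->
    width d m i < r ^+ m.+1 * width (c t) m i /\ width (c t) m i < r ^+ m.+1 * width d m i.
  by near: t; exact: wnear.
have := dot_stable (ltW r1) hd hct sd sct
  (fun i im => ltW (wt i (ltnW im) im).1) (fun i im => ltW (wt i (ltnW im) im).2).
move=> /le_lt_trans/(_ rQ) h.
have : (c t j - d j) ^+ 2 < e ^+ 2.
  apply: le_lt_trans h; rewrite (bigD1 (Ordinal jm)) //= lerDl.
  by apply: sumr_ge0 => i _; rewrite sqr_ge0.
by rewrite distrC -(real_normK (num_real (_ - _))) ltr_pXn2r ?nnegrE // ltW.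
Unshelve. all: by end_near. Qed.

End WidthBijection.

(** * Turning points of permutations *)

Section FilterIota.
Local Open Scope nat_scope.
Variables (P : pred nat) (N : nat).

(** The rank of [q] among the positions satisfying [P]; on those positions it is inverse to [nth] in
    the filtered list. *)
Definition before q := count P (iota 0 q).

Lemma beforeS q : before q.+1 = (before q + P q)%N.
Proof. by rewrite /before -addn1 iotaD count_cat /= addn0. Qed.

Lemma before_mono p q : (p <= q)%N -> (before p <= before q)%N.
Proof.
elim: q => [|q IH]; first by rewrite leqn0 => /eqP ->.
rewrite leq_eqVlt => /predU1P[->//|/IH h]; rewrite beforeS; lia.
Qed.

Lemma before_lt p q : P p -> (p < q)%N -> (before p < before q)%N.
Proof. by move=> Pp /before_mono; rewrite beforeS Pp addn1. Qed.

Let S := [seq p <- iota 0 N | P p].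

Lemma size_filter_iota : size S = before N.
Proof. by rewrite size_filter. Qed.

Lemma nth_before p : P p -> (p < N)%N -> nth 0%N S (before p) = p.
Proof.
move=> Pp pN; rewrite /S -(subnKC (ltnW pN)) iotaD filter_cat nth_cat.
rewrite size_filter ltnn subnn add0n.
have -> : (N - p = (N - p).-1.+1)%N by lia.
by rewrite /= Pp.
Qed.

Lemma nth_filterP j : (j < size S)%N ->
  [/\ P (nth 0%N S j), (nth 0%N S j < N)%N & before (nth 0%N S j) = j].
Proof.
move=> js; have := mem_nth 0%N js; rewrite mem_filter mem_iota add0n /=.
case/andP=> Pt tN; split=> //; apply/eqP.
rewrite -(@nth_uniq _ 0%N S) ?filter_uniq ?iota_uniq ?nth_before //.
by rewrite size_filter_iota before_lt.
Qed.

Lemma nth_filter_lt i j : (i < j)%N -> (j < size S)%N ->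
  (nth 0%N S i < nth 0%N S j)%N.
Proof.
move=> ij js; have [_ _ bi] := nth_filterP (ltn_trans ij js).
have [_ _ bj] := nth_filterP js; rewrite ltnNge; apply/negP => /before_mono.
by rewrite bi bj leqNgt ij.
Qed.

Lemma nth_filter_ltE q j : (j < size S)%N -> (nth 0%N S j < q)%N = (j < before q)%N.
Proof.
move=> js; have [Pt _ bj] := nth_filterP js.
by case: ltnP => h; apply/esym; [rewrite -[X in (X < _)%N]bj before_lt |
  rewrite ltnNge -[X in (_ <= X)%N]bj before_mono].
Qed.

End FilterIota.

(** * Directions and turns of a permutation with sentinels *)

Section Turns.
Local Open Scope nat_scope.
Variables (N : nat) (o : bool).
Implicit Types s : 'S_N.

(* One-line notation of s shifted by one and extended by the sentinels +oo or
   -oo (according to o) on the left and +oo on the right. *)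
Definition lev s q : nat :=
  if q is p.+1 then (if insub p is Some i then (s i).+1 else N.+1)
  else if o then N.+1 else 0%N.

Arguments lev : simpl never.

(** Because of the shift by one, [asc s q] compares letter q - 1 with letter q, so [turn s q] says
    that letter q is a local extremum. *)
Definition asc s q := (lev s q < lev s q.+1)%N.
Definition turn s q := asc s q != asc s q.+1.
Definition turns s := [seq p <- iota 0 N | turn s p].
Definition flats s := [seq p <- iota 0 N | ~~ turn s p].

Lemma levS s (p : 'I_N) : lev s p.+1 = (s p).+1.
Proof. by rewrite /lev insubT //= => ?; congr (s _).+1; apply/val_inj. Qed.

Lemma lev_out s p : (N <= p)%N -> lev s p.+1 = N.+1.
Proof. by move=> h; rewrite /lev insubF // ltnNge h. Qed.

Lemma levS_le s p : (p < N)%N -> (0 < lev s p.+1 <= N)%N.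
Proof. by move=> pN; rewrite (levS s (Ordinal pN)) /=. Qed.

Lemma asc0 s : (0 < N)%N -> asc s 0 = ~~ o.
Proof. by move=> N0; have := levS_le s N0; rewrite /asc /lev; case: o; lia. Qed.

Lemma ascN s : (0 < N)%N -> asc s N.
Proof.
move=> N0; rewrite /asc lev_out //; have := @levS_le s N.-1.
by rewrite prednK // => h; rewrite ltnS; have /andP[] := h (leqnn _).
Qed.

Lemma size_turns s : size (turns s) = \sum_(q < N) turn s q.
Proof.
rewrite size_filter -(big_mkord xpredT (fun q => turn s q : nat)).
by rewrite -sum1_count big_mkcond /index_iota subn0.
Qed.

Lemma size_turns_flats s : (size (turns s) + size (flats s) = N)%N.
Proof. by rewrite !size_filter count_predC size_iota. Qed.

End Turns.
Arguments turn {N}. Arguments turns {N}. Arguments flats {N}. Arguments asc {N}. Arguments lev {N} : simpl never.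

Lemma card_set_sum (T : finType) (P : pred T) :
  #|[set x | P x]%SET| = (\sum_x P x)%N.
Proof.
by rewrite -sum1_card big_mkcond; apply: eq_bigr => x _; rewrite inE; case: (P x).
Qed.

(** * Effect of inserting a maximal letter *)

Section Insertion.
Local Open Scope nat_scope.
Variable (N : nat) (o : bool).
Hypothesis N0 : (0 < N)%N.
Implicit Types (s : 'S_N) (i : 'I_N.+1).

Definition insmax i s : 'S_N.+1 := lift_perm i ord_max s.

Lemma lev_insmax i s q : lev o (insmax i s) q.+1 =
  if (q < i)%N then lev o s q.+1 else if q == i then N.+1 else
  if (q <= N)%N then lev o s q else N.+2.
Proof.
have [qN|qN] := ltnP q N.+1; last first.
  have iN := ltn_ord i; rewrite lev_out //.
  by rewrite ltnNge (leq_trans (ltnW iN) qN) gtn_eqF ?(leq_trans iN) // leqNgt qN.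
rewrite (levS _ _ (Ordinal qN)) /insmax.
case: (unliftP i (Ordinal qN)) => [j ej|ej].
  rewrite ej lift_perm_lift lift_max.
  have -> : q = lift i j by rewrite -ej.
  rewrite /= /bump; have := ltn_ord i; have := ltn_ord j.
  case: (leqP i j) => ij jN iN.
    rewrite add1n ltnNge (leqW ij) /= gtn_eqF ?ltnS // jN.
    by rewrite (levS o s j).
  by rewrite add0n ij (levS o s j).
by rewrite ej lift_perm_id /= -[q]/(val (Ordinal qN)) ej ltnn eqxx.
Qed.

Lemma asc_insmax i s q : (q <= N.+1)%N -> asc o (insmax i s) q =
  if (q < i)%N then asc o s q else if q == i then (0 < i)%N || ~~ o else
  if q == i.+1 then i == N :> nat else asc o s q.-1.
Proof.
move=> qN; have iN := ltn_ord i.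
rewrite /asc (lev_insmax i s q).
case: q qN => [|q] qN.
  case: (ltnP 0 i) => i0.
    by rewrite /lev; have := levS_le o s N0; rewrite /lev; case: o; lia.
  have -> : (0%N == i :> nat) by lia.
  by rewrite /lev; case: o; lia.
rewrite lev_insmax.
have [qi|qi] := ltnP q.+1 i.
  by rewrite (ltnW qi).
have [qi1|qni] := eqVneq (q.+1)%N (i : nat).
  have qi' : (q < i)%N by lia.
  have qN' : (q < N)%N by lia.
  by rewrite qi'; have := levS_le o s qN'; lia.
have -> : (q < i)%N = false by lia.
rewrite eqSS; have [->|qi'] := eqVneq q (i : nat).
  have [iN'|iN'] := ltnP i N; last by lia.
  by have := levS_le o s iN'; lia.
have -> : (q <= N)%N by lia.
have [qN'|qN'] := ltnP q N; first by [].
have -> : q = N by lia.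
by have := ascN o s N0; rewrite /asc /= [lev o s N.+1]lev_out // => h; rewrite h; lia.
Qed.

(** Beside a peak, the new maximum takes over as the peak; at the right end, and at the left end
    when its sentinel is +oo, it prolongs a monotone run. Elsewhere it is a new peak and turns a
    neighbour into a new valley. *)
Definition neutral s (i : nat) := if i == N then true else if i == 0%N then o || (asc o s 0 && ~~ asc o s 1)
  else (asc o s i.-1 && ~~ asc o s i) || (asc o s i && ~~ asc o s i.+1).

(** Turns away from the place [i] are kept, up to a shift on its right. The sums are split there,
    and the positions i - 1, i, i + 1 are settled by cases on the directions. *)
Lemma size_turns_insmax i s :
  size (turns o (insmax i s)) = (size (turns o s) + (~~ neutral s i).*2)%N.
Proof.
rewrite !size_turns.
have sumE n (P : nat -> bool) : (\sum_(q < n) P q = \sum_(0 <= q < n) P q)%N.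
  by rewrite big_mkord.
rewrite (sumE N.+1 (turn o (insmax i s))) (sumE N (turn o s)).
have iN : (i <= N)%N := ltn_ord i.
have aN := ascN o s N0; have a0 := asc0 o s N0.
have A q : (q <= N.+1)%N -> asc o (insmax i s) q = if q < i then asc o s q else
    if q == i then (0 < i) || ~~ o else if q == i.+1 then i == N :> nat
    else asc o s q.-1 by apply: asc_insmax.
have Ai : asc o (insmax i s) i = (0 < i) || ~~ o by rewrite A ?ltnn ?eqxx // leqW.
have Ai1 : asc o (insmax i s) i.+1 = (i == N :> nat).
  by rewrite A // ltnNge leqnSn /= gtn_eqF // eqxx.
have Ai2 : i < N -> asc o (insmax i s) i.+2 = asc o s i.+1.
  move=> h; rewrite A //; have -> : (i.+2 < i) = false by lia.
  have -> : (i.+2 == i :> nat) = false by lia.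
  by have -> : (i.+2 == i.+1 :> nat) = false by lia.
have Aj j : j < i -> asc o (insmax i s) j = asc o s j.
  by move=> h; rewrite A ?h //; lia.
have E1 : \sum_(0 <= q < i.-1) turn o (insmax i s) q =
    \sum_(0 <= q < i.-1) turn o s q.
  by apply: eq_big_nat => q /andP[_ qj]; rewrite /turn !Aj //; lia.
have E2 : (\sum_(i.+2 <= q < N.+1) turn o (insmax i s) q =
    \sum_(i.+1 <= q < N) turn o s q)%N.
  rewrite big_add1 /=; apply: eq_big_nat => q /andP[qi qj].
  rewrite /turn !asc_insmax; try lia.
  have -> : (q.+1 < i)%N = false by lia.
  have -> : (q.+2 < i)%N = false by lia.
  have -> : (q.+1 == i :> nat) = false by lia.
  have -> : (q.+2 == i :> nat) = false by lia.
  have -> : (q.+1 == i.+1)%N = false by lia.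
  by have -> : (q.+2 == i.+1)%N = false by lia.
have sp n (f : nat -> nat) : n < N.+1 -> \sum_(0 <= q < N.+1) f q =
    \sum_(0 <= q < n.-1) f q + (if 0 < n then f n.-1 else 0) + f n +
    \sum_(n.+1 <= q < N.+1) f q.
  move=> nN; rewrite (@big_cat_nat _ _ _ n) //= ?(ltnW nN) //.
  rewrite (big_ltn nN) addnA; congr (_ + _ + _).
  by case: n {nN} => [|k]; rewrite ?big_nil //= big_nat_recr.
have sp' n (f : nat -> nat) : n < N -> \sum_(0 <= q < N) f q =
    \sum_(0 <= q < n.-1) f q + (if 0 < n then f n.-1 else 0) + f n +
    \sum_(n.+1 <= q < N) f q.
  move=> nN; rewrite (@big_cat_nat _ _ _ n) //= ?(ltnW nN) //.
  rewrite (big_ltn nN) addnA; congr (_ + _ + _).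
  by case: n {nN} => [|k]; rewrite ?big_nil //= big_nat_recr.
rewrite (sp i) // E1.
have [iN'|iN'] := ltnP i N; last first.
  have ei : i = N :> nat by lia.
  rewrite /neutral ei eqxx N0 [\sum_(N.+1 <= q < N.+1) _]big_geq //= double0 !addn0.
  have -> : \sum_(0 <= q < N) turn o s q = \sum_(0 <= q < N.-1) turn o s q + turn o s N.-1.
    by rewrite -(big_nat_recr N.-1) // prednK.
  rewrite -addnA; congr (_ + _).
  rewrite /turn prednK // Aj ?ei ?prednK //.
  have -> : asc o (insmax i s) N = true by rewrite -[N in asc _ _ N]ei Ai ei N0.
  have -> : asc o (insmax i s) N.+1 = true by rewrite -[N in asc _ _ N.+1]ei Ai1 ei eqxx.
  by rewrite aN addn0.
rewrite (sp' i) // [\sum_(i.+1 <= q < N.+1) _]big_ltn // E2.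
rewrite /turn Ai Ai1 Ai2 // /neutral (ltn_eqF iN').
set S1 := \sum_(0 <= q < _) _; set S2 := \sum_(i.+1 <= q < N) _.
case: (posnP i) => [i0|i0].
  rewrite i0 /= a0; case: (asc o s 1); case: (o) => /=; lia.
rewrite prednK // Aj ?prednK //.
by case: (asc o s i.-1); case: (asc o s i); case: (asc o s i.+1); rewrite /=; lia.
Qed.

(** With D peaks and U valleys, telescoping the directions between the sentinels gives U = D + o.
    Each peak has two neutral places beside it, shared with no other peak as adjacent letters are
    never both peaks; the ends add o + 1. The total 2 D + o + 1 is D + U + 1. *)
Lemma sum_neutral s : \sum_(i < N.+1) neutral s i = (size (turns o s)).+1.
Proof.
have a0 := asc0 o s N0; have aN := ascN o s N0.
pose D q : nat := asc o s q && ~~ asc o s q.+1.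
pose U q : nat := ~~ asc o s q && asc o s q.+1.
have tE q : (turn o s q : nat) = D q + U q.
  by rewrite /turn /D /U; case: asc; case: asc.
have tel n : \sum_(q < n) U q + asc o s 0 = \sum_(q < n) D q + asc o s n.
  elim: n => [|n IH]; first by rewrite !big_ord0.
  rewrite !big_ord_recr /=; move: IH; rewrite /D /U.
  by case: (asc o s n); case: (asc o s n.+1) => /=; lia.
rewrite size_turns (eq_bigr (fun q : 'I_N => D q + U q)) => [|q _]; last exact: tE.
rewrite big_split /=; have := tel N; rewrite aN a0.
have -> : \sum_(i < N.+1) neutral s i = \sum_(q < N) D q + \sum_(q < N.-1) D q + o + 1.
  pose nd' q := if q == 0 then o || (asc o s 0 && ~~ asc o s 1)
    else (asc o s q.-1 && ~~ asc o s q) || (asc o s q && ~~ asc o s q.+1).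
  have nd'E n : \sum_(q < n.+1) nd' q = \sum_(q < n.+1) D q + \sum_(q < n) D q + o.
    elim: n => [|n IH].
      rewrite !big_ord1 big_ord0 /D /nd' eqxx a0.
      by case: (asc o s 1); case: (o) => /=; lia.
    rewrite big_ord_recr /= IH [\sum_(q < n.+2) _]big_ord_recr [\sum_(q < n.+1) D q]big_ord_recr /=.
    rewrite {1}/nd' /= /D.
    by case: (asc o s n); case: (asc o s n.+1); case: (asc o s n.+2) => /=; lia.
  rewrite big_ord_recr /= {2}/neutral eqxx; congr (_ + _).
  have := nd'E N.-1; rewrite (prednK N0) => <-.
  by apply: eq_bigr => q _; rewrite /neutral /nd' ltn_eqF.
have -> : \sum_(q < N) D q = \sum_(q < N.-1) D q + D N.-1.
  by rewrite -[in LHS](prednK N0) big_ord_recr.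
have -> : D N.-1 = 0 by rewrite /D prednK // aN andbF.
by case: (o) => /=; lia.
Qed.

End Insertion.

(** * Recurrence for permutations with a given number of turns *)

Section Counting.
Local Open Scope nat_scope.

Definition nturns o N k := #|[set s : 'S_N | size (turns o s) == k]%SET|.

Lemma insmax_bij N : bijective (fun p : 'I_N.+1 * 'S_N => insmax p.1 p.2).
Proof.
apply: inj_card_bij; last first.
  by rewrite card_prod card_ord !card_Sn factS.
move=> [i s] [j t] /= e.
have ij : i = j.
  apply: (@perm_inj _ (insmax i s)); rewrite {2}e.
  by rewrite /insmax !lift_perm_id.
subst j; congr (_, _); apply/permP => p; apply: (@lift_inj _ ord_max).
by rewrite -!(lift_perm_lift i) -/(insmax i s) e.
Qed.

(* Inserting the maximum keeps the number of turns at exactly k + 1 places and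
   increases it by 2 elsewhere. *)
Lemma nturnsS o N k : 0 < N ->
  nturns o N.+1 k = k.+1 * nturns o N k +
    (if k is k'.+2 then (N - k') * nturns o N k' else 0).
Proof.
move=> N0; rewrite /nturns !card_set_sum (reindex _ (onW_bij _ (insmax_bij N))) /=.
rewrite -(pair_bigA _ (fun i s => (size (turns o (insmax i s)) == k) : nat)) /=.
rewrite exchange_big /=.
transitivity (\sum_(s : 'S_N) (k.+1 * (size (turns o s) == k) +
   (if k is k'.+2 then (N - k') * (size (turns o s) == k') else 0))); last first.
  rewrite big_split /= -big_distrr /=; congr (_ + _).
  case: k => [|[|k]]; [by rewrite big1 | by rewrite big1 |].
  by rewrite card_set_sum big_distrr.
apply: eq_bigr => s _.
have tN : size (turns o s) <= N by have := size_turns_flats o s; lia.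
under eq_bigr do rewrite size_turns_insmax //.
have n1 : \sum_(i < N.+1) neutral o s i = (size (turns o s)).+1 by apply: sum_neutral.
have n2 : \sum_(i < N.+1) ~~ neutral o s i = N - size (turns o s).
  have : \sum_(i < N.+1) neutral o s i + \sum_(i < N.+1) ~~ neutral o s i = N.+1.
    rewrite -big_split /= -[RHS](card_ord N.+1) -sum1_card.
    by apply: eq_bigr => i _; case: neutral.
  by rewrite n1; lia.
rewrite (eq_bigr (fun i : 'I_N.+1 => (size (turns o s) == k) * neutral o s i +
    ((size (turns o s)).+2 == k) * ~~ neutral o s i)); last first.
  move=> i _; have -> : (~~ neutral o s i).*2 = if neutral o s i then 0 else 2.
    by case: neutral.
  by case: neutral; rewrite ?addn0 ?addn2 ?muln1 ?muln0 ?addn0.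
rewrite big_split /= -!big_distrr /= n1 n2.
case: k => [|[|k]]; rewrite ?eqSS.
- by case: eqVneq => [->|]; lia.
- by case: eqVneq => [->|]; lia.
by case: eqVneq => [->|]; case: eqVneq => [->|]; lia.
Qed.

End Counting.

(** * Cells of very nice M-morsifications *)

(** A relatively open piece is also relatively closed, since every other point of [A] has a
    neighbourhood in a different piece; so a component meeting a piece lies in it. *)
Lemma card_components (T : topologicalType) (A : set T) (I : finType) (E : I -> set T) :
  A = \bigcup_i E i -> (forall i, connected (E i)) -> (forall i, E i !=set0) ->
  (forall i j x, E i x -> E j x -> i = j) ->
  (forall i x, E i x -> \forall y \near x, A y -> E i y) ->
  finite_set (components A) /\ #|` fset_set (components A)|%fset = #|I|.
Proof.
move=> AE Ec E0 Ed Eo.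
have sEA i : E i `<=` A by rewrite AE; exact: bigcup_sup.
have comp i x : E i x -> connected_component A x = E i.
  move=> Eix; apply/seteqP; split; last exact: connected_component_max (Ec i).
  have xA : A x by exact: sEA Eix.
  have cC := @component_connected _ A x; set C := connected_component A x in cC *.
  have CA : C `<=` A by exact: connected_component_sub.
  have Cx : C x by exact: connected_component_refl.
  pose B := C `&` E i.
  suff -> : C = B by move=> y [].
  apply/esym/cC; first by exists x.
  - exists (interior [set y | A y -> E i y]); first exact: open_interior.
    apply/seteqP; split => y [Cy].
      by move=> Ey; split => //; exact: Eo.
    by move=> /interior_subset /(_ (CA _ Cy)).
  - exists (~` interior [set y | A y -> ~ E i y]).
      by apply: open_closedC; exact: open_interior.
    apply/seteqP; split => y [Cy].
      by move=> Ey; split => // /interior_subset /(_ (CA _ Cy)).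
    move=> nint; split=> //; apply: contrapT => nEy; apply: nint.
    have [j _ Ejy] : (\bigcup_i E i) y by rewrite -AE; exact: CA.
    apply: filterS (Eo j y Ejy) => z h Az Eiz.
    by apply: nEy; rewrite (Ed i j z Eiz (h Az)).
have cE : components A = range E.
  apply/seteqP; split => [_ [x Ax <-]|_ [i _ <-]].
    by move: Ax; rewrite AE => -[i _ Eix]; exists i => //; rewrite -AE (comp i).
  by have [x Eix] := E0 i; exists x; [exact: sEA Eix | exact: comp].
have Einj : injective E.
  move=> i j e; have [x Eix] := E0 i; apply: (Ed i j x) => //.
  by rewrite -e.
have fin : finite_set (range E) by apply: finite_image; exact: finite_finset.
split; rewrite cE //.
rewrite fset_set_image; last exact: finite_finset.
rewrite card_imfset //=.
have -> : fset_set [set: I] = [fset x in enum I]%fset.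
  apply/fsetP => x; rewrite in_fset_set; last exact: finite_finset.
  by rewrite in_setT; apply/esym; rewrite inE /= mem_enum.
by rewrite card_fseq undup_id ?enum_uniq // cardE.
Qed.

(** * Increasing enumerations and coefficients of normalized polynomials *)

Section Cells.
Variable R : realType.
Implicit Types (c d z v : nat -> R) (p q f : {poly R}).

Lemma inc_inj z N i j : inc z N -> (i < N)%N -> (j < N)%N -> z i = z j -> i = j.
Proof.
move=> hz iN jN e; have [ij|ji|//] := ltngtP i j.
  by have := hz _ _ ij jN; rewrite e ltxx.
by have := hz _ _ ji iN; rewrite e ltxx.
Qed.

Lemma inc_mem_eq z z' N N' : inc z N -> inc z' N' ->
  [seq z i | i <- iota 0 N] =i [seq z' i | i <- iota 0 N'] ->
  N = N' /\ forall i, (i < N)%N -> z i = z' i.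
Proof.
have srt (y : nat -> R) n : inc y n -> sorted <%O [seq y i | i <- iota 0 n].
  move=> hy; apply/(sortedP 0) => i; rewrite size_map size_iota => im.
  by rewrite !(nth_map 0%N) ?size_iota ?(ltnW im) // !nth_iota ?(ltnW im) // !add0n hy.
move=> hz hz' e; have {}e := lt_sorted_eq (srt z N hz) (srt z' N' hz') e.
have NN : N = N' by have := congr1 size e; rewrite !size_map !size_iota.
split=> // i iN; have := congr1 (fun s => nth 0 s i) e.
by rewrite /= !(nth_map 0%N) ?size_iota -?NN // !nth_iota -?NN // !add0n.
Qed.

Lemma root_cprod c m x : root (cprod c m) x = (x \in [seq c i | i <- iota 0 m]).
Proof. by rewrite cprod_seq root_prod_XsubC. Qed.

Lemma cprod_inj c d m : inc c m -> inc d m -> cprod c m = cprod d m ->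
  forall i, (i < m)%N -> c i = d i.
Proof.
move=> hc hd e; have [|_ h] := inc_mem_eq hc hd; last exact: h.
by move=> x; rewrite -!root_cprod e.
Qed.

Lemma critpoly_slot_mono c m i x y : inslot c m i x -> inslot c m i y -> x < y ->
  0 < (-1) ^+ (m - i) * ((critpoly c m).[y] - (critpoly c m).[x]).
Proof.
move=> hx hy xy; apply: critpoly_mono => // z /andP[xz zy] j jm.
have := hx j jm; have := hy j jm; case: ifP => _ h1 h2.
  exact: lt_trans h2 xz.
exact: lt_trans zy h1.
Qed.

Lemma critpoly_lead c m : (critpoly c m)`_m.+1 = 1.
Proof. by rewrite critpoly_coef ltnSn cprod_lead mulr1 divff // pnatr_eq0. Qed.

Lemma size_critpoly_eq c m : size (critpoly c m) = m.+2.
Proof.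
apply/eqP; rewrite eqn_leq size_critpoly /= ltnNge; apply/negP => h.
by have := critpoly_lead c m; rewrite nth_default // => /esym/eqP; rewrite oner_eq0.
Qed.

Lemma size_Ppoly n (lam : 'rV[R]_(n - 2)) : (size (Ppoly n lam) <= n.+1)%N.
Proof.
rewrite /Ppoly; case: eqP => [_|_]; first by rewrite size_poly0.
rewrite (leq_trans (size_polyD _ _)) // geq_max size_polyXn leqnn /=.
rewrite (leq_trans (size_sum _ _ _)) //; apply/bigmax_leqP => i _.
rewrite (leq_trans (size_scale_leq _ _)) // size_polyXn; lia.
Qed.

Lemma coef_Ppoly m (lam : 'rV[R]_(m.+1 - 2)) k : (Ppoly m.+1 lam)`_k =
  (k == m.+1)%:R + \sum_(i < m.+1 - 2) lam 0 i * (k == (m.+1 - 2 - i)%N)%:R.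
Proof.
rewrite /Ppoly /= coefD coefXn coef_sum; congr (_ + _).
by apply: eq_bigr => i _; rewrite coefZ coefXn.
Qed.

Lemma coef_Ppoly_lam m (lam : 'rV[R]_(m.+1 - 2)) (i : 'I_(m.+1 - 2)) :
  (Ppoly m.+1 lam)`_(m.+1 - 2 - i) = lam 0 i.
Proof.
have im := ltn_ord i; rewrite coef_Ppoly (bigD1 i) //= eqxx mulr1 big1 => [|j ji].
  have -> : (m.+1 - 2 - i == m.+1)%N = false by lia.
  by rewrite add0r addr0.
have jm := ltn_ord j.
have -> : (m.+1 - 2 - i == m.+1 - 2 - j)%N = false.
  by apply/negP => h; move/negP: ji; apply; apply/eqP/val_inj => /=; lia.
by rewrite mulr0.
Qed.

Lemma coef_Ppoly_out m (lam : 'rV[R]_(m.+1 - 2)) k :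
  (k == 0%N) || (k == m) -> (Ppoly m.+1 lam)`_k = 0.
Proof.
move=> km; rewrite coef_Ppoly big1 ?addr0 => [|i _].
  by have -> : (k == m.+1)%N = false by lia.
have im := ltn_ord i.
have -> : (k == m.+1 - 2 - i)%N = false by lia.
by rewrite mulr0.
Qed.

Definition lam_of c m : 'rV[R]_(m.+1 - 2) := \row_i (critpoly c m)`_(m.+1 - 2 - i).

Lemma Ppoly_lam_of c m : \sum_(j < m) c j = 0 -> Ppoly m.+1 (lam_of c m) = critpoly c m.
Proof.
move=> c0; apply/polyP => k.
have [/eqP ->|k0] := boolP (k == 0%N).
  by rewrite coef_Ppoly_out ?eqxx // critpoly_coef /= invr0 mulr0.
have [/eqP ->|km] := boolP (k == m).
  rewrite coef_Ppoly_out ?eqxx ?orbT // critpoly_coef ltnW //.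
  case: m c0  => [|m] c0; first by rewrite invr0 mulr0.
  by rewrite cprod_coef1 c0 oppr0 mulr0 mul0r.
have [/eqP ->|km1] := boolP (k == m.+1).
  rewrite critpoly_lead coef_Ppoly eqxx big1 ?addr0 // => i _.
  have -> : (m.+1 == m.+1 - 2 - i)%N = false by have := ltn_ord i; lia.
  by rewrite mulr0.
have [mk|mk] := ltnP m.+1 k.
  by rewrite !nth_default // (leq_trans _ mk) ?size_Ppoly ?size_critpoly.
have ik : (m.+1 - 2 - k < m.+1 - 2)%N by lia.
have -> : k = (m.+1 - 2 - Ordinal ik)%N by rewrite /=; lia.
by rewrite coef_Ppoly_lam mxE.
Qed.

(** The missing term of degree m forces the critical points to be centred, and the missing constant
    term selects the primitive. *)
Lemma Ppoly_critpoly m (lam : 'rV[R]_(m.+1 - 2)) c :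
  deriv (Ppoly m.+1 lam) = m.+1%:R *: cprod c m ->
  [/\ \sum_(j < m) c j = 0, Ppoly m.+1 lam = critpoly c m & lam = lam_of c m].
Proof.
move=> e.
have c0 : \sum_(j < m) c j = 0.
  case: m lam e => [|m] lam e; first by rewrite big_ord0.
  have := congr1 (fun p : {poly R} => p`_m) e; rewrite /= coef_deriv coefZ cprod_coef1.
  rewrite coef_Ppoly_out ?eqxx ?orbT // mul0rn => /esym/eqP.
  by rewrite mulf_eq0 pnatr_eq0 oppr_eq0 /= => /eqP.
have fE : Ppoly m.+1 lam = critpoly c m.
  have e' : deriv (Ppoly m.+1 lam) = deriv (critpoly c m) by rewrite deriv_critpoly.
  apply/polyP => k; case: k => [|k].
    by rewrite coef_Ppoly_out // -horner_coef0 critpoly0.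
  have := congr1 (fun p : {poly R} => p`_k) e'; rewrite /= !coef_deriv.
  by rewrite -(mulr_natr (Ppoly _ _)`__) -(mulr_natr (critpoly _ _)`__) => /mulIf ->; rewrite ?pnatr_eq0.
split=> //; apply/rowP => i; rewrite mxE -fE.
by rewrite coef_Ppoly_lam.
Qed.

End Cells.

(** * Solving f = y inside one slot *)

Section Slots.
Variable R : realType.
Implicit Types (c : nat -> R).

Lemma slot_inj c m i x y : inslot c m i x -> inslot c m i y ->
  (critpoly c m).[x] = (critpoly c m).[y] -> x = y.
Proof.
move=> hx hy e; have [xy|yx|//] := ltgtP x y.
  by have := critpoly_slot_mono hx hy xy; rewrite e subrr mulr0 ltxx.
by have := critpoly_slot_mono hy hx yx; rewrite e subrr mulr0 ltxx.
Qed.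

Lemma critpoly_pinfty c m y : exists B, forall x, B <= x -> y < (critpoly c m).[x].
Proof.
pose p := critpoly c m - y%:P.
have sp : size p = m.+2.
  by rewrite size_polyDl size_critpoly_eq // size_polyN (leq_ltn_trans (size_polyC_leq1 _)).
have lp : lead_coef p = 1.
  by rewrite lead_coefE sp /= coefB coefC /= subr0 critpoly_lead.
have [|B hB] := @poly_pinfty_gt_lc _ p; first by rewrite lp ltr01.
exists B => x /hB; rewrite lp !hornerE; lra.
Qed.

(** Reduced to the behaviour at +oo by the dilation of ratio -1. *)
Lemma critpoly_minfty c m y :
  exists A, forall x, x <= A -> 0 < (-1) ^+ m * (y - (critpoly c m).[x]).
Proof.
have [B hB] := critpoly_pinfty (fun j => -1 * c j) m ((-1) ^+ m.+1 * y).
exists (- B) => x xB; have := hB (-1 * x); rewrite critpoly_scale exprS.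
rewrite -!mulrA !mulN1r lerNr => /(_ xB); lra.
Qed.

(** A finite end of the slot is a critical point; an infinite end is replaced by a point far out,
    where f has passed [y]. *)
Lemma slot_ivt c m i y : inc c m -> (i <= m)%N ->
  ((0 < i)%N -> 0 < (-1) ^+ (m - i) * (y - (critpoly c m).[c i.-1])) ->
  ((i < m)%N -> 0 < (-1) ^+ (m - i) * ((critpoly c m).[c i] - y)) ->
  exists2 x, inslot c m i x & (critpoly c m).[x] = y.
Proof.
move=> hc im hl hr; set sg : R := (-1) ^+ (m - i) in hl hr *.
have [A [Ai Am Ay]] : exists A, [/\ forall j, (j < i)%N -> c j <= A,
    (i < m)%N -> A < c i & 0 < sg * (y - (critpoly c m).[A])].
  case: (posnP i) => [i0|i0].
    have [A hA] := critpoly_minfty c m y.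
    exists (Num.min A (c i - 1)); split.
    - by move=> j; rewrite i0.
    - by move=> _; rewrite gt_min; apply/orP; right; lra.
    - by rewrite /sg i0 subn0 hA // ge_min lexx.
  exists (c i.-1); split; [|by move=> h; apply: hc => //; lia|exact: hl].
  by move=> j ji; apply: inc_le hc _ _; lia.
have [B [AB Bm By]] : exists B, [/\ A < B,
    forall j, (i <= j < m)%N -> B <= c j & 0 < sg * ((critpoly c m).[B] - y)].
  have [im'|im'] := ltnP i m.
    exists (c i); split; [exact: Am | | exact: hr].
    by move=> j /andP[ij jm]; apply: inc_le hc _ _.
  have [B hB] := critpoly_pinfty c m y.
  exists (Num.max B (A + 1)); split.
  - by rewrite lt_max; apply/orP; right; lra.
  - by move=> j; lia.
  - have -> : sg = 1 by rewrite /sg; have -> : (m - i = 0)%N by lia.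
    by rewrite mul1r subr_gt0 hB // le_max lexx.
have [||x /itvP xAB /rootP] := @poly_ivtoo _ (sg *: (critpoly c m - y%:P)) A B.
- exact: ltW.
- have := mulr_gt0 Ay By; rewrite -oppr_lt0; congr (_ < 0).
  by rewrite !hornerZ !hornerD !hornerN !hornerC; ring.
rewrite !hornerE => /eqP; rewrite mulf_eq0 signr_eq0 /= subr_eq0 => /eqP xy.
exists x => // j jm; case: ltnP => ij.
  by apply: le_lt_trans (Ai j ij) _; rewrite xAB.
by apply: lt_le_trans (Bm j _); rewrite ?xAB // ij.
Qed.

End Slots.

(** * From a value pattern to critical points and special points *)

Section Pattern.
Variables (R : realType) (N m : nat) (s : 'S_N).
(** The left sentinel is +oo for odd [m], since the degree m + 1 is then even. *)
Let o := odd m.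
Hypothesis sm : size (turns o s) = m.
Implicit Types (c v z : nat -> R).

Local Notation bf := (before (turn o s)).
Local Notation tn := (nth 0%N (turns o s)).

Definition has_pattern v := forall p q : 'I_N, (s p < s q)%N -> v p < v q.

Let bfN : bf N = m. Proof. by rewrite -sm -size_filter_iota. Qed.

Lemma turns_ltn j : (j < m)%N -> (tn j < N)%N.
Proof. by rewrite -sm => /nth_filterP[]. Qed.

Lemma before_turns j : (j < m)%N -> bf (tn j) = j.
Proof. by rewrite -sm => /nth_filterP[]. Qed.

Lemma turn_turns j : (j < m)%N -> turn o s (tn j).
Proof. by rewrite -sm => /nth_filterP[]. Qed.

Lemma turns_before p : (p < N)%N -> turn o s p -> tn (bf p) = p.
Proof. by move=> pN tp; apply: nth_before. Qed.

Lemma before_le p : (p <= N)%N -> (bf p <= m)%N.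
Proof. by move=> pN; rewrite -bfN before_mono. Qed.

Lemma before_ltn p : (p < N)%N -> turn o s p -> (bf p < m)%N.
Proof. by move=> pN tp; rewrite -bfN before_lt. Qed.

(** Directions flip exactly at turns, starting from the one imposed by the left sentinel. Hence the
    step into [q] has the sign of the derivative in slot [bf q]. *)
Lemma asc_before q : (q <= N)%N -> asc o s q = ~~ odd (m - bf q).
Proof.
elim: q => [|q IH] qN.
  rewrite subn0; have [N0|N0] := posnP N; last exact: asc0.
  have m0 : m = 0%N by have := size_turns_flats o s; rewrite sm; lia.
  by rewrite /asc /lev insubF ?N0 // /o m0.
have bq := before_le qN; rewrite beforeS in bq *.
have := IH (ltnW qN).
have -> : (m - bf q = m - (bf q + turn o s q) + turn o s q)%N by lia.
rewrite oddD oddb => h.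
by move: h; rewrite {3}/turn; case: (asc o s q); case: (asc o s q.+1); case: (odd _).
Qed.

Lemma pattern_step v q : has_pattern v -> (0 < q < N)%N ->
  0 < (-1) ^+ (m - bf q) * (v q - v q.-1).
Proof.
move=> hv /andP[q0 qN].
have qN' : (q.-1 < N)%N by lia.
have := asc_before (ltnW qN); rewrite -signr_odd /asc.
have := levS o s (Ordinal qN); have := levS o s (Ordinal qN'); rewrite /= prednK // => -> ->.
rewrite ltnS; have [lt|ge] := ltnP (s (Ordinal qN')) (s (Ordinal qN)).
  by case: odd => // _; rewrite expr0 mul1r subr_gt0 (hv _ _ lt).
case: odd => // _; rewrite expr1 mulN1r opprB subr_gt0.
apply: (hv (Ordinal qN) (Ordinal qN')); rewrite ltn_neqAle ge andbT.
by apply/negP => /eqP/val_inj/perm_inj/(congr1 val) /=; lia.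
Qed.

(** The index [bf p.+1] counts a turn at [p] itself, so runs starting at a critical point and at a
    boundary point are treated alike. *)
Lemma pattern_chain v p q : has_pattern v -> (p < q < N)%N ->
  (forall r, (p < r < q)%N -> ~~ turn o s r) ->
  0 < (-1) ^+ (m - bf p.+1) * (v q - v p).
Proof.
move=> hv; elim: q => // q IH /andP[pq qN] hr.
have := pattern_step hv (_ : (0 < q.+1 < N)%N) => /(_ qN) /=.
move: pq; rewrite ltnS leq_eqVlt => /predU1P[->//|pq].
have bE r : (p < r <= q)%N -> bf r.+1 = bf p.+1.
  elim: r => // r IHr /andP[pr rq]; rewrite beforeS (negPf (hr r.+1 _)) ?pr //.
  rewrite addn0; move: pr; rewrite ltnS leq_eqVlt => /predU1P[->//|pr].
  by apply: IHr; rewrite pr ltnW.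
rewrite (bE q) ?pq ?leqnn // => h1.
have : 0 < (-1) ^+ (m - bf p.+1) * (v q - v p).
  by apply: IH => [|r /andP[pr rq]]; [rewrite pq ltnW | rewrite hr // pr ltnW].
move: h1; lra.
Qed.

Lemma pattern_turns v j : has_pattern v -> (j.+1 < m)%N ->
  0 < (-1) ^+ (m - j.+1) * (v (tn j.+1) - v (tn j)).
Proof.
move=> hv jm; have jm' := ltnW jm.
have := @pattern_chain v (tn j) (tn j.+1) hv.
rewrite beforeS before_turns // turn_turns // addn1; apply.
  by rewrite turns_ltn // andbT nth_filter_lt // sm.
move=> r /andP[jr rj]; apply/negP => tr.
have := before_lt (turn_turns jm') jr; have := before_lt tr rj.
by rewrite !before_turns //; lia.
Qed.

Lemma pattern_left v p : has_pattern v -> (p < N)%N -> ~~ turn o s p -> (0 < bf p)%N ->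
  0 < (-1) ^+ (m - bf p) * (v p - v (tn (bf p).-1)).
Proof.
move=> hv pN np b0; have bm := before_le (ltnW pN).
have jm : ((bf p).-1 < m)%N by lia.
have := @pattern_chain v (tn (bf p).-1) p hv.
rewrite beforeS before_turns // turn_turns // addn1 prednK //; apply.
  by rewrite pN andbT nth_filter_ltE ?sm // prednK.
move=> r /andP[jr rp]; apply/negP => tr.
have := before_lt (turn_turns jm) jr; have := before_lt tr rp.
by rewrite !before_turns //; lia.
Qed.

Lemma pattern_right v p : has_pattern v -> (p < N)%N -> ~~ turn o s p -> (bf p < m)%N ->
  0 < (-1) ^+ (m - bf p) * (v (tn (bf p)) - v p).
Proof.
move=> hv pN np bm.
have := @pattern_chain v p (tn (bf p)) hv.
rewrite beforeS (negPf np) addn0; apply.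
  rewrite turns_ltn // andbT ltn_neqAle leqNgt nth_filter_ltE ?sm // ltnn andbT.
  by apply: contraNneq np => ->; apply: turn_turns.
move=> r /andP[jr rp]; apply/negP => tr.
have := before_lt tr rp; rewrite before_turns //.
by have := before_mono (turn o s) (ltnW jr); lia.
Qed.

(* c lists critical points whose critical values, up to the constant k, are the
   values of v at the turns of s. *)
Definition fits v c k := [/\ inc c m, \sum_(j < m) c j = 0 &
  forall j, (j < m)%N -> (critpoly c m).[c j] + k = v (tn j)].

(** The prescribed heights are the signed differences of consecutive critical values, positive by
    the pattern. The constant is read off the first critical value; when there is none it is
    normalized to 0, which keeps uniqueness. *)
Lemma exists_fits v : has_pattern v -> exists c, exists2 k, fits v c k & (m = 0%N -> k = 0).
Proof.
move=> hv.
have [|c [hc c0 wc]] := @exists_width R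
  (fun j => (-1) ^+ (m - j.+1) * (v (tn j.+1) - v (tn j))) m.
  by move=> j jm; apply: pattern_turns.
pose k := if m == 0%N then 0 else v (tn 0) - (critpoly c m).[c 0%N].
exists c; exists k; last by rewrite /k => ->.
split=> // j; elim: j => [|j IH] jm.
  by rewrite /k gtn_eqF //; ring.
have := IH (ltnW jm); have := wc j jm; rewrite /width => /(mulfI _) h.
by have := h (negbT (signr_eq0 _ _)); lra.
Qed.

Lemma fits_unique v c k c' k' : fits v c k -> fits v c' k' ->
  (m = 0%N -> k = k') -> (forall j, (j < m)%N -> c j = c' j) /\ k = k'.
Proof.
move=> [hc c0 vc] [hc' c0' vc'] m0.
have e : forall j, (j < m)%N -> c j = c' j.
  apply: width_inj => // j jm; congr (_ * _).
  have := vc j (ltnW jm); have := vc j.+1 jm.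
  by have := vc' j (ltnW jm); have := vc' j.+1 jm; lra.
split=> //; have [//|mp] := posnP m.
by have := vc 0%N mp; have := vc' 0%N mp; rewrite (eq_critpoly e) (e 0%N mp); lra.
Qed.

Definition fits_at v c k z := [/\ fits v c k, inc z N,
  forall j, (j < m)%N -> z (tn j) = c j,
  forall p, (p < N)%N -> (critpoly c m).[z p] + k = v p &
  forall p, (p < N)%N -> ~~ turn o s p -> inslot c m (bf p) (z p)].

(** Off the turns, [v p] is on the required side of each neighbouring critical value, so [slot_ivt]
    finds a point in the slot [bf p]. Points sharing a slot are ordered by monotonicity of f
    there. *)
Lemma exists_fits_at v c k : has_pattern v -> fits v c k -> exists z, fits_at v c k z.
Proof.
move=> hv hf; have [hc c0 vc] := hf.
have ex p : exists x, (p < N)%N -> if turn o s p then x = c (bf p) else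
    inslot c m (bf p) x /\ (critpoly c m).[x] + k = v p.
  case: (ltnP p N) => [pN|]; last by exists 0.
  have [tp|tp] := boolP (turn o s p); first by exists (c (bf p)).
  have [|||x hx ex] := @slot_ivt R c m (bf p) (v p - k) hc.
  - exact/before_le/ltnW.
  - move=> b0; have jm : ((bf p).-1 < m)%N by have := before_le (ltnW pN); lia.
    by have := pattern_left hv pN tp b0; rewrite -(vc _ jm); congr (0 < _ * _); ring.
  - move=> bm; have := pattern_right hv pN tp bm.
    by rewrite -(vc _ bm); congr (0 < _ * _); ring.
  by exists x => _; split=> //; rewrite ex; ring.
have /choice[z hz] := ex.
have zt p : (p < N)%N -> turn o s p -> z p = c (bf p).
  by move=> pN tp; have := hz p pN; rewrite tp.
have zf p : (p < N)%N -> ~~ turn o s p -> inslot c m (bf p) (z p) /\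
    (critpoly c m).[z p] + k = v p.
  by move=> pN /negPf tp; have := hz p pN; rewrite tp.
exists z; split=> //.
- apply: inc_step => p pN; have pN' := ltnW pN.
  have bS := beforeS (turn o s) p.
  have [tp|tp] := boolP (turn o s p); have [tq|tq] := boolP (turn o s p.+1).
  + by rewrite !zt //; apply: hc; rewrite ?before_ltn // bS tp addn1.
  + have [/(_ (bf p) (before_ltn pN' tp)) hs _] := zf _ pN tq.
    by rewrite zt //; move: hs; rewrite bS tp addn1 ltnSn.
  + have bm := before_ltn pN tq; rewrite bS (negPf tp) addn0 in bm.
    have [/(_ (bf p) bm) hs _] := zf _ pN' tp.
    by rewrite (zt p.+1) // bS (negPf tp) addn0; move: hs; rewrite ltnn.
  + have [hs vp] := zf _ pN' tp; have [] := zf _ pN tq.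
    rewrite bS (negPf tp) addn0 => hs' vq.
    have := pattern_step hv (_ : (0 < p.+1 < N)%N) => /(_ pN) /=.
    rewrite -vp -vq bS (negPf tp) addn0 => h.
    have [//|zz|zz] := ltgtP (z p) (z p.+1); last by rewrite zz subrr mulr0 ltxx in h.
    by have := critpoly_slot_mono hs' hs zz; lra.
- by move=> j jm; rewrite zt ?turns_ltn ?turn_turns // before_turns.
- move=> p pN; have [tp|tp] := boolP (turn o s p); last by have [] := zf p pN tp.
  by rewrite zt // vc ?before_ltn // turns_before.
- by move=> p pN tp; have [] := zf p pN tp.
Qed.

Lemma fits_at_unique v c k z c' k' z' : fits_at v c k z -> fits_at v c' k' z' ->
  (m = 0%N -> k = k') ->
  (forall j, (j < m)%N -> c j = c' j) /\ (forall p, (p < N)%N -> z p = z' p).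
Proof.
move=> [hf _ zt zv zs] [hf' _ zt' zv' zs'] m0.
have [cE kE] := fits_unique hf hf' m0; split=> // p pN.
have [tp|tp] := boolP (turn o s p).
  by rewrite -(turns_before pN tp) zt ?zt' ?cE ?before_ltn.
have sl' : inslot c m (bf p) (z' p).
  by move=> j jm; rewrite (cE j jm); exact: zs'.
apply: slot_inj (zs p pN tp) sl' _.
by have := zv p pN; have := zv' p pN; rewrite (eq_critpoly cE) kE; lra.
Qed.

End Pattern.

(** * Limits and finitely many simultaneous conditions *)

Section Near.
Variables (T : Type) (F : set_system T).
Context {FF : Filter F}.

Lemma near_forall_ltn n (P : T -> nat -> Prop) :
  (forall j, (j < n)%N -> \forall t \near F, P t j) ->
  \forall t \near F, forall j, (j < n)%N -> P t j.
Proof.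
elim: n => [|n IH] h; first by apply: nearW.
have h1 := h n (ltnSn n).
have h2 := IH (fun j jn => h j (ltnW jn)).
near=> t => j; rewrite ltnS leq_eqVlt => /predU1P[->|jn].
  by near: t.
by move: j jn; near: t.
Unshelve. all: by end_near. Qed.

Variable R : realType.

Lemma cvg_row n (u : T -> 'I_n -> R) (l : 'I_n -> R) :
  (forall i, u t i @[t --> F] --> l i) ->
  (\row_i u t i : 'rV[R]_n) @[t --> F] --> (\row_i l i : 'rV[R]_n).
Proof.
move=> h A [P hP sP]; rewrite /fmap /=.
have h1 : \forall t \near F, forall i, P ord0 i (u t i).
  by apply: filter_forall => i; apply: h; have := hP ord0 i; rewrite mxE.
apply: filterS h1 => t ht; apply: sP => i j /=.
by rewrite mxE ord1.
Qed.

Lemma near_inslot (c : T -> nat -> R) d m i x :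
  (forall j, (j < m)%N -> c t j @[t --> F] --> d j) -> inslot d m i x ->
  \forall t \near F, inslot (c t) m i x.
Proof.
move=> cd hx; apply: near_forall_ltn => j jm; have := hx j jm; case: ifP => _ h.
  exact: (cvgr_lt _ (cd j jm)).
exact: (cvgr_gt _ (cd j jm)).
Qed.

End Near.

(** * Cells, and continuity of the special points in the values *)

Section Cell.
Variables (R : realType) (m l : nat).
Local Notation N := (m + l)%N.
Local Notation o := (odd m).
Local Notation config := ('rV[R]_(m.+1 - 2) * 'rV[R]_l)%type.
Implicit Types (e : config) (s : 'S_N) (g : 'S_l) (c z v : nat -> R).

(* The configurations whose special points z 0 < ... < z (N - 1) take values in
   the relative order s; the critical points are those at the turns of s and
   the labelling of the remaining ones is g. *)
Definition cell (s : 'S_N) (g : 'S_l) : set config :=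
  [set e : config | exists z, let f := Ppoly m.+1 e.1 in
    [/\ inc z N, has_pattern s (fun p => f.[z p]),
        deriv f = m.+1%:R *: cprod (fun j => z (nth 0%N (turns o s) j)) m
      & forall i : 'I_l, e.2 0 i = z (nth 0%N (flats o s) (g i))]].

Lemma size_flats s : size (turns o s) = m -> size (flats o s) = l.
Proof. by move=> sm; have := size_turns_flats o s; lia. Qed.

Lemma flats_ltn s (i : 'I_l) : size (turns o s) = m -> (nth 0%N (flats o s) i < N)%N.
Proof. by move=> sm; have [] := @nth_filterP (fun p => ~~ turn o s p) N i; rewrite // size_flats. Qed.

Lemma flat_flats s (i : 'I_l) : size (turns o s) = m -> ~~ turn o s (nth 0%N (flats o s) i).
Proof. by move=> sm; have [] := @nth_filterP (fun p => ~~ turn o s p) N i; rewrite // size_flats. Qed.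

Lemma cell_fits s e z : size (turns o s) = m -> let f := Ppoly m.+1 e.1 in
  inc z N -> has_pattern s (fun p => f.[z p]) ->
  deriv f = m.+1%:R *: cprod (fun j => z (nth 0%N (turns o s) j)) m ->
  fits_at m s (fun p => f.[z p]) (fun j => z (nth 0%N (turns o s) j)) 0 z.
Proof.
move=> sm f hz hp df; have [c0 fE lamE] := Ppoly_critpoly df.
split=> //.
- split=> //.
    move=> i j ij jm; apply: hz; last exact: turns_ltn.
    by apply: nth_filter_lt; rewrite // sm.
  by move=> j jm; rewrite addr0 -fE.
- by move=> p pN; rewrite addr0 -fE.
- move=> p pN tp j jm; rewrite -(nth_filter_ltE (N := N)) ?sm // -/(turns o s).
  case: ltnP => jp; first exact: hz.
  apply: hz; last exact: turns_ltn.
  rewrite ltn_neqAle jp andbT; apply: contraNneq tp => ->.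
  exact: turn_turns.
Qed.

Lemma fits_cell s g v c k z : size (turns o s) = m -> has_pattern s v ->
  fits_at m s v c k z ->
  cell s g (lam_of c m, \row_i z (nth 0%N (flats o s) (g i))).
Proof.
move=> sm hp [[hc c0 vc] hz zt zv zs]; exists z; rewrite /= Ppoly_lam_of //; split=> //.
- move=> p q /hp; have := zv p (ltn_ord p); have := zv q (ltn_ord q); lra.
- by rewrite deriv_critpoly; congr (_ *: _); apply: eq_cprod => j /zt.
- by move=> i; rewrite mxE.
Qed.

(** Critical points follow the heights by [cvg_width_inv]. A boundary point is trapped between
    [z0 p - h] and [z0 p + h]: f is monotone in its slot, and for nearby parameters its values at
    these two points lie on both sides of the prescribed one. *)
Lemma cvg_fits_at (T : Type) (F : set_system T) (FF : Filter F) s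
    (v : T -> nat -> R) (c : T -> nat -> R) (k : T -> R) (z : T -> nat -> R) v0 c0 k0 z0 :
  size (turns o s) = m ->
  (forall p, v t p @[t --> F] --> v0 p) ->
  (forall t, fits_at m s (v t) (c t) (k t) (z t)) -> fits_at m s v0 c0 k0 z0 ->
  (forall t, m = 0%N -> k t = k0) ->
  (forall j, (j < m)%N -> c t j @[t --> F] --> c0 j) /\
  (forall p, (p < N)%N -> z t p @[t --> F] --> z0 p).
Proof.
move=> sm vv ft f0 km.
have [[hc0 sc0 vc0] hz0 zt0 zv0 zs0] := f0.
have cc : forall j, (j < m)%N -> c t j @[t --> F] --> c0 j.
  apply: cvg_width_inv => //.
    by apply: nearW => t; have [[? ? _]] := ft t.
  have wE c' k' v' z' i : fits_at m s v' c' k' z' -> (i.+1 < m)%N -> width c' m i =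
      (-1) ^+ (m - i.+1) * (v' (nth 0%N (turns o s) i.+1) - v' (nth 0%N (turns o s) i)).
    move=> [[_ _ vc] _ _ _ _] im; rewrite -!vc ?(ltnW im) // /width; congr (_ * _); ring.
  move=> i im; under eq_fun do rewrite (wE _ _ _ _ _ (ft _) im).
  rewrite (wE _ _ _ _ _ f0 im); apply: cvgMr; apply: cvgB; exact: vv.
split=> // p pN.
have kk : k t @[t --> F] --> k0.
  have [m0|m0] := posnP m.
    by under eq_fun do rewrite km //; exact: cvg_cst.
  have kE t : k t = v t (nth 0%N (turns o s) 0) - (critpoly (c t) m).[c t 0%N].
    by have [[_ _ vc] _ _ _ _] := ft t; rewrite -vc //; ring.
  under eq_fun do rewrite kE.
  have -> : k0 = v0 (nth 0%N (turns o s) 0) - (critpoly c0 m).[c0 0%N].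
    by rewrite -vc0 //; ring.
  by apply: cvgB; [exact: vv | apply: cvg_critpoly => //; exact: cc].
have [tp|tp] := boolP (turn o s p).
  have zE t : z t p = c t (before (turn o s) p).
    have [_ _ zt _ _] := ft t; rewrite -{1}(turns_before pN tp) zt //.
    exact: before_ltn.
  under eq_fun do rewrite zE; rewrite -(turns_before pN tp) zt0 ?before_ltn //.
  rewrite turns_before //; apply: cc; exact: before_ltn.
set i := before (turn o s) p; set sg : R := (-1) ^+ (m - i).
have hs := zs0 p pN tp; rewrite -/i in hs.
apply/cvgrPdist_lt => eps eps0.
(* A radius below the distance to every critical point keeps both test points in the slot. *)
have [|h0 h00 hh] := @small_pos R m (fun j => `|z0 p - c0 j|) (fun=> -1).
  move=> j jm; rewrite normr_gt0 subr_eq0; have := hs j jm.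
  by case: ifP => _ h; [rewrite gt_eqF | rewrite lt_eqF].
pose h := Num.min h0 (eps / 2).
have hp : 0 < h by rewrite lt_min h00 divr_gt0.
have {hh}hj j : (j < m)%N -> h < `|z0 p - c0 j|.
  move=> jm; have := hh h; rewrite hp ge_min lexx /= => /(_ isT j jm); lra.
have he : h < eps by rewrite gt_min; apply/orP; right; lra.
have sl : inslot c0 m i (z0 p - h).
  move=> j jm; have := hs j jm; have := hj j jm; case: ifP => _ h1 h2; last by lra.
  by move: h1; rewrite gtr0_norm ?subr_gt0 //; lra.
have sr : inslot c0 m i (z0 p + h).
  move=> j jm; have := hs j jm; have := hj j jm; case: ifP => _ h1 h2; first by lra.
  by move: h1; rewrite ltr0_norm ?subr_lt0 //; lra.
have ml := critpoly_slot_mono sl hs (_ : z0 p - h < z0 p).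
have mr := critpoly_slot_mono hs sr (_ : z0 p < z0 p + h).
have nl : \forall t \near F, sg * ((critpoly (c t) m).[z0 p - h] + k t - v t p) < 0.
  apply: (@cvgr_lt _ _ F FF _ (sg * ((critpoly c0 m).[z0 p - h] + k0 - v0 p))).
    apply: cvgMr; apply: cvgB; last exact: vv.
    by apply: cvgD => //; apply: cvg_critpoly => //; exact: cvg_cst.
  by rewrite -(zv0 p pN); have := ml; rewrite -/sg => /(_ _); lra.
have nr : \forall t \near F, 0 < sg * ((critpoly (c t) m).[z0 p + h] + k t - v t p).
  apply: (@cvgr_gt _ _ F FF _ (sg * ((critpoly c0 m).[z0 p + h] + k0 - v0 p))).
    apply: cvgMr; apply: cvgB; last exact: vv.
    by apply: cvgD => //; apply: cvg_critpoly => //; exact: cvg_cst.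
  by rewrite -(zv0 p pN); have := mr; rewrite -/sg => /(_ _); lra.
have nsl := near_inslot cc sl; have nsr := near_inslot cc sr.
near=> t.
have [_ _ _ zv zs] := ft t.
have ht := zs p pN tp; rewrite -/i in ht; have vt := zv p pN.
have tl : inslot (c t) m i (z0 p - h) by near: t; exact: nsl.
have tr : inslot (c t) m i (z0 p + h) by near: t; exact: nsr.
have tvl : sg * ((critpoly (c t) m).[z0 p - h] + k t - v t p) < 0 by near: t.
have tvr : 0 < sg * ((critpoly (c t) m).[z0 p + h] + k t - v t p) by near: t.
have zl : z0 p - h < z t p.
  rewrite ltNge le_eqVlt; apply/negP => /predU1P[e|e].
    by move: tvl; rewrite -e -vt subrr mulr0 ltxx.
  by have := critpoly_slot_mono ht tl e; rewrite -/sg; move: tvl; rewrite -vt; lra.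
have zr : z t p < z0 p + h.
  rewrite ltNge le_eqVlt; apply/negP => /predU1P[e|e].
    by move: tvr; rewrite e -vt subrr mulr0 ltxx.
  by have := critpoly_slot_mono tr ht e; rewrite -/sg; move: tvr; rewrite -vt; lra.
rewrite ltr_norml; apply/andP; split; lra.
Unshelve. all: by end_near. Qed.

End Cell.

(** * Cells are nonempty, connected and relatively open *)

Section CellTopology.
Variables (R : realType) (m l : nat).
Local Notation N := (m + l)%N.
Local Notation o := (odd m).
Local Notation config := ('rV[R]_(m.+1 - 2) * 'rV[R]_l)%type.
Implicit Types (e : config) (s : 'S_N) (g : 'S_l) (c z v : nat -> R).

Lemma cell_nonempty s g : size (turns o s) = m -> @cell R m l s g !=set0.
Proof.
move=> sm; pose v p : R := (lev o s p.+1)%:R.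
have hv : has_pattern s v by move=> p q pq; rewrite /v !levS ltr_nat ltnS.
have [c [k hf _]] := exists_fits sm hv.
by have [z /(fits_cell g sm hv) h] := exists_fits_at sm hv hf; eexists; exact: h.
Qed.

Lemma cell_connected s g : size (turns o s) = m -> connected (@cell R m l s g).
Proof.
move=> sm.
suff H e0 e1 : cell s g e0 -> cell s g e1 ->
    exists C, [/\ connected C, C `<=` cell s g, C e0 & C e1].
  have [e0 c0] := cell_nonempty g sm.
  have /choice[C hC] : forall e1, exists C, cell s g e1 ->
      [/\ connected C, C `<=` cell s g, C e0 & C e1].
    move=> e1; have [c1|] := pselect (cell s g e1); last by exists set0.
    by have [C ?] := H _ _ c0 c1; exists C.
  have -> : cell s g = \bigcup_(e in cell s g) C e.
    apply/seteqP; split => [e ce|e [e1 ce1]]; first by exists e => //; have [] := hC e ce.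
    by have [_ h _ _] := hC e1 ce1; exact: h.
  apply: bigcup_connected; first by exists e0 => e /hC[].
  by move=> e /hC[].
case: e0 e1 => [lam0 b0] [lam1 b1] [z0 /= [hz0 hp0 df0 hb0]] [z1 /= [hz1 hp1 df1 hb1]].
(* The weights (1 - t)^2 and t^2 never vanish together, so that the path is
   defined for all real t. *)
pose v (t : R) (p : nat) : R := (1 - t) * (1 - t) * (Ppoly m.+1 lam0).[z0 p] + t * t * (Ppoly m.+1 lam1).[z1 p].
have hv t : has_pattern s (v t).
  move=> p q pq; rewrite /v.
  have h0 := hp0 p q pq; have h1 := hp1 p q pq.
  have [->|t0] := eqVneq t 0; first by rewrite subr0 mulr0 !mul1r !mul0r !addr0.
  rewrite -!expr2 ler_ltD //; first by rewrite ler_wpM2l ?sqr_ge0 // ltW.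
  by rewrite ltr_pM2l // exprn_even_gt0.
(* The lift is chosen separately for each t: [cvg_fits_at] makes it continuous whatever the choice,
   and [fits_at_unique] makes it pass through the two given configurations. *)
have /choice[G hG] t : exists ckz : (nat -> R) * R * (nat -> R),
    fits_at m s (v t) ckz.1.1 ckz.1.2 ckz.2 /\ (m = 0%N -> ckz.1.2 = 0).
  have [c [k hf k0]] := exists_fits sm (hv t).
  by have [z hz] := exists_fits_at sm (hv t) hf; exists (c, k, z).
pose Phi (t : R) : config := (lam_of (G t).1.1 m,
  \row_i (G t).2 (nth 0%N (flats o s) (g i))).
have PhiE t lam (b : 'rV[R]_l) z : inc z N -> has_pattern s (fun p => (Ppoly m.+1 lam).[z p]) ->
    deriv (Ppoly m.+1 lam) = m.+1%:R *: cprod (fun j => z (nth 0%N (turns o s) j)) m ->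
    (forall i, b 0 i = z (nth 0%N (flats o s) (g i))) ->
    v t = (fun p => (Ppoly m.+1 lam).[z p]) -> Phi t = (lam, b).
  move=> hz hp df hb vE; have hf := cell_fits (e := (lam, b)) sm hz hp df.
  have [gf g0] := hG t; rewrite /= -vE in hf.
  have [|cE zE] := fits_at_unique sm gf hf; first exact: g0.
  rewrite /Phi; congr (_, _).
    have [_ _ ->] := Ppoly_critpoly df.
    by rewrite /lam_of (eq_critpoly cE).
  by apply/rowP => i; rewrite mxE hb zE ?flats_ltn.
exists (Phi @` setT); split.
- apply: connected_continuous_connected.
    by apply/connected_intervalP => x y _ _ w _.
  apply: continuous_subspaceT => t.
  have vc p : v x p @[x --> t] --> v t p.
    have h1 : 1 - x @[x --> t] --> 1 - t by apply: cvgB; [exact: cvg_cst | exact: cvg_id].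
    have h2 : x @[x --> t] --> t by exact: cvg_id.
    apply: cvgD; apply: cvgMl; exact: cvgM.
  have [x m0|cc zz] := @cvg_fits_at R m l _ (nbhs t) _ s v _ _ _ _ _ _ _ sm vc
    (fun x => (hG x).1) (hG t).1.
    by rewrite (hG x).2 ?(hG t).2.
  have A1 : lam_of (G x).1.1 m @[x --> t] --> lam_of (G t).1.1 m.
    by apply: cvg_row => i; exact: cvg_critpoly_coef.
  have A2 : (Phi x).2 @[x --> t] --> (Phi t).2.
    by apply: cvg_row => i; apply: zz; apply: flats_ltn.
  exact: (cvg_pair A1 A2).
- move=> _ [t _ <-]; have [gf _] := hG t; exact: fits_cell (hv t) gf.
- exists 0 => //; apply: (PhiE 0 lam0 b0 z0) => //.
  by apply/funext => p; rewrite /v subr0 !mul1r !mul0r addr0.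
- exists 1 => //; apply: (PhiE 1 lam1 b1 z1) => //.
  by apply/funext => p; rewrite /v subrr !mul0r add0r !mul1r.
Qed.

(** Distinct critical values exclude repeated critical points, so the sorted list is strictly
    increasing. *)
Lemma very_nice_crit e : very_nice R m.+1 l e ->
  exists c, inc c m /\ deriv (Ppoly m.+1 e.1) = m.+1%:R *: cprod c m.
Proof.
move=> [r [sr df ur]].
have {ur} ur : uniq r.
  by move: ur; rewrite cat_uniq => /andP[/map_uniq].
pose c j := nth 0 (sort <=%O r) j.
have ss : size (sort <=%O r) = m by rewrite size_sort.
exists c; split.
  have /(sortedP 0) st : sorted <%O (sort <=%O r) by rewrite sort_lt_sorted.
  by apply: inc_step => i im; apply: st; rewrite ss.
rewrite df; congr (_ *: _); rewrite -(perm_big _ (permEl (perm_sort <=%O r))) /=.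
by rewrite (big_nth 0) ss /cprod big_mkord.
Qed.

Lemma cvg_Ppoly (T : Type) (F : set_system T) (FF : Filter F)
    (lam : T -> 'rV[R]_(m.+1 - 2)) (lam0 : 'rV[R]_(m.+1 - 2)) i :
  (forall j, lam t 0 j @[t --> F] --> lam0 0 j) ->
  (Ppoly m.+1 (lam t))`_i @[t --> F] --> (Ppoly m.+1 lam0)`_i.
Proof.
move=> h; under eq_fun do rewrite coef_Ppoly; rewrite coef_Ppoly.
apply: cvgD; first exact: cvg_cst.
by apply: cvg_ord_sum => j; apply: cvgMl.
Qed.

Lemma cvg_config_fst e0 j : (e : config).1 0 j @[e --> e0] --> e0.1 0 j.
Proof.
apply: (@cvg_comp _ _ _ fst (fun M : 'rV[R]_(m.+1 - 2) => M 0 j) (nbhs e0) (nbhs e0.1)).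
  exact: cvg_fst.
exact: coord_continuous.
Qed.

Lemma cvg_config_snd e0 j : (e : config).2 0 j @[e --> e0] --> e0.2 0 j.
Proof.
apply: (@cvg_comp _ _ _ snd (fun M : 'rV[R]_l => M 0 j) (nbhs e0) (nbhs e0.2)).
  exact: cvg_snd.
exact: coord_continuous.
Qed.

(** Near [e0] the derivative still changes sign across small windows around the old critical points,
    so the critical points converge; boundary points are coordinates. The order of the special
    points and of their values is then kept, being given by strict inequalities. *)
Lemma cell_open s g e0 : size (turns o s) = m -> cell s g e0 ->
  \forall e \near e0, very_nice R m.+1 l e -> cell s g e.
Proof.
move=> sm [z0 /= [hz0 hp0 df0 hb0]].
have [[hc0 _ _] _ _ _ _] := cell_fits sm hz0 hp0 df0.
set c0 := (fun j => z0 _) in df0 hc0.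
have /choice[C hC] e : exists c, very_nice R m.+1 l e ->
    inc c m /\ deriv (Ppoly m.+1 e.1) = m.+1%:R *: cprod c m.
  have [/very_nice_crit[c ?]|] := pselect (very_nice R m.+1 l e); last by exists (fun=> 0).
  by exists c.
pose F := within (very_nice R m.+1 l) (nbhs e0).
have FF : Filter F by apply: within_filter.
have VF : \forall e \near F, very_nice R m.+1 l e by apply: withinT.
have fc k : (Ppoly m.+1 e.1)`_k @[e --> e0] --> (Ppoly m.+1 e0.1)`_k.
  by apply: (@cvg_Ppoly _ (nbhs e0)) => j; exact: cvg_config_fst.
pose Q e : {poly R} := m.+1%:R^-1 *: deriv (Ppoly m.+1 e.1).
have QE e c : deriv (Ppoly m.+1 e.1) = m.+1%:R *: cprod c m -> Q e = cprod c m.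
  by rewrite /Q => ->; rewrite scalerA mulVf ?scale1r // pnatr_eq0.
have sQ e : (size (Q e) <= m.+1)%N.
  rewrite (leq_trans (size_scale_leq _ _)) //.
  have [->|fn] := eqVneq (Ppoly m.+1 e.1) 0; first by rewrite deriv0 size_poly0.
  by rewrite -ltnS; apply: leq_trans (lt_size_deriv fn) (size_Ppoly _).
have Qc x : (Q e).[x] @[e --> e0] --> (Q e0).[x].
  apply: (@cvg_horner _ _ (nbhs e0) _ _ _ m.+1) => //; last exact: cvg_cst.
  move=> k _; rewrite /Q coefZ coef_deriv; under eq_fun do rewrite coefZ coef_deriv.
  by apply: cvgMr; rewrite -mulr_natr; under eq_fun do rewrite -mulr_natr; apply: cvgMl.
have Cc j : (j < m)%N -> C e j @[e --> F] --> c0 j.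
  move=> jm; apply/cvgrPdist_lt => eps eps0.
  (* The factor -2 keeps the windows of radius [h] around consecutive critical points disjoint. *)
  have [|h0 h00 hh] := @small_pos R m.-1 (fun i => c0 i.+1 - c0 i) (fun=> -2).
    by move=> i im; rewrite subr_gt0; apply: hc0 => //; lia.
  pose h := Num.min h0 eps.
  have hp : 0 < h by rewrite lt_min h00.
  have hgap i : (i.+1 < m)%N -> c0 i + h <= c0 i.+1 - h.
    move=> im; have := hh h; rewrite hp ge_min lexx /= => /(_ isT i).
    have -> : (i < m.-1)%N by lia.
    by move=> /(_ isT); lra.
  have he : h <= eps by rewrite ge_min lexx orbT.
  have sgn i : (i < m)%N -> (Q e0).[c0 i - h] * (Q e0).[c0 i + h] < 0.
    move=> im; rewrite (QE e0 c0 df0); apply: (sign_change im).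
      apply: cprod_slot_sign => k km; case: ltnP => ki.
        have ik : (k.+1 < m)%N by lia.
        by have := hgap k ik; have := inc_le hc0 ki im; lra.
      by have := inc_le hc0 ki km; lra.
    apply: cprod_slot_sign => k km; rewrite ltnS; case: leqP => ki.
      by have := inc_le hc0 ki im; lra.
    have ik : (i.+1 < m)%N by lia.
    by have := hgap i ik; have := inc_le hc0 ki km; lra.
  have near_sgn : \forall e \near F, forall i, (i < m)%N ->
      (Q e).[c0 i - h] * (Q e).[c0 i + h] < 0.
    apply: near_forall_ltn => i im; apply: (cvg_within _).
    by apply: (cvgr_lt _ (cvgM (Qc (c0 i - h)) (Qc (c0 i + h)))); exact: sgn.
  near=> e.
  have Ve : very_nice R m.+1 l e by near: e.
  have [hCe dCe] := hC e Ve; have QeE := QE e _ dCe.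
  have se : forall i, (i < m)%N -> (Q e).[c0 i - h] * (Q e).[c0 i + h] < 0 by near: e.
  have [|//|||d dw Qd] := @roots_in_windows R (fun i => c0 i - h) (fun i => c0 i + h) (Q e) m _ hgap.
  - by move=> i im; lra.
  - by rewrite QeE monic_cprod.
  - by rewrite QeE size_cprod.
  - exact: se.
  have hd : inc d m.
    apply: inc_step => i im; have /andP[_ a] := dw i (ltnW im).
    by have /andP[b _] := dw i.+1 im; have := hgap i im; lra.
  have := cprod_inj hCe hd; rewrite -QeE -Qd => /(_ erefl j jm) ->.
  by have /andP[a b] := dw j jm; rewrite ltr_norml; apply/andP; split; lra.
pose bg := before (fun p => ~~ turn o s p).
(* The special points by position: critical points at the turns of [s], elsewhere the boundary point
   whose label [g] sends to the rank of the position among the flats. *)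
pose Z e p := if turn o s p then C e (before (turn o s) p) else
  if insub (bg p) is Some k then e.2 0 ((g^-1)%g k) else 0.
have Zt e j : (j < m)%N -> Z e (nth 0%N (turns o s) j) = C e j.
  by move=> jm; rewrite /Z turn_turns // before_turns.
have Zf e (i : 'I_l) : Z e (nth 0%N (flats o s) (g i)) = e.2 0 i.
  rewrite /Z (negPf (flat_flats (g i) sm)) /bg.
  have [|_ _ ->] := @nth_filterP (fun p => ~~ turn o s p) N (g i); first by rewrite size_flats.
  by rewrite valK permK.
have Zc p : (p < N)%N -> Z e p @[e --> F] --> z0 p.
  move=> pN; have [tp|tp] := boolP (turn o s p).
    have bm := before_ltn sm pN tp.
    rewrite -(turns_before pN tp); under eq_fun do rewrite Zt //.
    exact: (Cc (before (turn o s) p)).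
  have bl : (bg p < l)%N.
    by rewrite -(size_flats sm) size_filter_iota; apply: before_lt.
  have pE : p = nth 0%N (flats o s) (g ((g^-1)%g (Ordinal bl))).
    by rewrite permKV /= nth_before.
  rewrite pE -hb0; under eq_fun do rewrite Zf.
  by apply: cvg_within_filter; exact: cvg_config_snd.
have Vc p : (p < N)%N -> (Ppoly m.+1 e.1).[Z e p] @[e --> F] --> (Ppoly m.+1 e0.1).[z0 p].
  move=> pN; apply: (@cvg_horner _ _ _ _ _ _ m.+2) => [e||k _|]; rewrite ?size_Ppoly //.
    by apply: cvg_within_filter.
  exact: Zc.
have near_inc : \forall e \near F, forall p, (p < N.-1)%N -> Z e p < Z e p.+1.
  apply: near_forall_ltn => p pN.
  have pN' : (p.+1 < N)%N by lia.
  have := @cvgr_gt _ _ F FF _ _ (cvgB (Zc _ pN') (Zc _ (ltnW pN'))) 0.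
  rewrite subr_gt0 => /(_ FF (hz0 _ _ (ltnSn p) pN')).
  by apply: filterS => e; rewrite subr_gt0.
have near_pat : \forall e \near F, has_pattern s (fun p => (Ppoly m.+1 e.1).[Z e p]).
  apply: filter_forall => p; apply: filter_forall => q.
  have [pq|_] := boolP (s p < s q)%N; last by apply: nearW.
  have := @cvgr_gt _ _ F FF _ _ (cvgB (Vc _ (ltn_ord q)) (Vc _ (ltn_ord p))) 0.
  rewrite subr_gt0 => /(_ FF (hp0 _ _ pq)).
  by apply: filterS => e; rewrite subr_gt0.
suff : \forall e \near F, cell s g e by [].
near=> e.
have Ve : very_nice R m.+1 l e by near: e.
have [hCe dCe] := hC e Ve.
exists (Z e); split.
- by apply: inc_step => p pN; have : (p < N.-1)%N by [lia]; move: p {pN}; near: e.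
- by near: e.
- by rewrite dCe; congr (_ *: _); apply: eq_cprod => j jm; rewrite Zt.
- by move=> i; rewrite Zf.
Unshelve. all: by end_near. Qed.

End CellTopology.

(** * Cells are very nice and pairwise disjoint *)

Section CellPartition.
Variables (R : realType) (m l : nat).
Local Notation N := (m + l)%N.
Local Notation o := (odd m).
Local Notation config := ('rV[R]_(m.+1 - 2) * 'rV[R]_l)%type.
Implicit Types (e : config) (s : 'S_N) (g : 'S_l) (c z v : nat -> R).

Lemma pattern_inj s v p q : has_pattern s v -> (p < N)%N -> (q < N)%N ->
  v p = v q -> p = q.
Proof.
move=> hv pN qN e; have [lt|lt|] := ltngtP (s (Ordinal pN)) (s (Ordinal qN)).
- by have := hv _ _ lt; rewrite /= e ltxx.
- by have := hv _ _ lt; rewrite /= e ltxx.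
by move=> /val_inj/perm_inj[].
Qed.

Lemma turns_map s : size (turns o s) = m ->
  [seq nth 0%N (turns o s) j | j <- iota 0 m] = turns o s.
Proof. by move=> sm; rewrite -[X in iota _ X]sm; exact: mkseq_nth. Qed.

Lemma special_points s g e z : size (turns o s) = m ->
  (forall i : 'I_l, e.2 0 i = z (nth 0%N (flats o s) (g i))) ->
  perm_eq ([seq z (nth 0%N (turns o s) j) | j <- iota 0 m] ++
           [seq e.2 0 i | i <- enum 'I_l])
    [seq z p | p <- iota 0 N].
Proof.
move=> sm eb.
have -> : [seq z (nth 0%N (turns o s) j) | j <- iota 0 m] = map z (turns o s).
  by rewrite -[in RHS](turns_map sm) -map_comp.
have -> : [seq e.2 0 i | i <- enum 'I_l] =
    map z [seq nth 0%N (flats o s) (g i) | i <- enum 'I_l].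
  by rewrite -map_comp; apply: eq_map => i; rewrite eb.
rewrite -map_cat perm_map //.
have sf := size_flats sm.
have p1 : perm_eq [seq nth 0%N (flats o s) (g i) | i <- enum 'I_l] (flats o s).
  have e1 : flats o s = [seq nth 0%N (flats o s) (val i) | i <- enum 'I_l].
    apply: (@eq_from_nth _ 0%N); first by rewrite size_map size_enum_ord.
    move=> i il; rewrite sf in il.
    rewrite (nth_map (Ordinal il)) ?size_enum_ord //.
    by rewrite /= nth_enum_ord.
  rewrite {2}e1 (map_comp (fun i : 'I_l => nth 0%N (flats o s) (val i)) g).
  apply: perm_map; apply: uniq_perm; rewrite ?(map_inj_uniq (@perm_inj _ g)) ?enum_uniq //.
  move=> i; rewrite mem_enum inE; apply/mapP; exists ((g^-1)%g i); rewrite ?mem_enum //.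
  by rewrite permKV.
rewrite (perm_trans (perm_cat (perm_refl _) p1)) //.
by rewrite /turns /flats perm_filterC.
Qed.

Lemma cell_sub s g e : size (turns o s) = m -> cell s g e -> very_nice R m.+1 l e.
Proof.
move=> sm [z /= [hz hp df eb]]; set f := Ppoly m.+1 e.1 in hp df *.
exists [seq z (nth 0%N (turns o s) j) | j <- iota 0 m]; split.
- by rewrite size_map size_iota.
- by rewrite df cprod_seq.
have -> : [seq f.[e.2 0 i] | i <- enum 'I_l] = map (horner f) [seq e.2 0 i | i <- enum 'I_l].
  by rewrite -[RHS]map_comp; apply: eq_map.
rewrite -map_cat (perm_uniq (perm_map _ (special_points sm eb))).
rewrite -map_comp map_inj_in_uniq ?iota_uniq // => p q.
rewrite !mem_iota !add0n => /= pN qN; exact: (pattern_inj hp).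
Qed.

(** A letter is its own rank: [s p] is the number of [q] with [s q] below [s p]. *)
Lemma perm_order_eq s s' : (forall p q, (s p < s q)%N = (s' p < s' q)%N) -> s = s'.
Proof.
move=> h; apply/permP => p; apply/val_inj.
have rk (t : 'S_N) : (t p : nat) = #|[set q | (t q < t p)%N]%SET|.
  rewrite -(card_imset _ (@perm_inj _ t)).
  have -> : t @: [set q | (t q < t p)%N]%SET = [set q : 'I_N | (q < t p)%N]%SET.
    apply/setP => q; rewrite !inE; apply/imsetP/idP => [[r]|qp].
      by rewrite inE => rp ->.
    by exists ((t^-1)%g q); rewrite ?inE permKV.
  rewrite card_set_sum.
  transitivity (\sum_(q < N | (q < t p)%N) 1)%N; last by rewrite big_mkcond; apply: eq_bigr => q _; case: ltnP.
  by rewrite -(big_ord_widen N (fun=> 1%N) (ltnW (ltn_ord (t p)))) sum_nat_const card_ord muln1.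
by rewrite /= (rk s) (rk s'); apply: eq_card => q; rewrite !inE h.
Qed.

(** The roots of the derivative and the boundary points are read off [e], and sorting them recovers
    [z]. The order of the values gives [s], the positions of the boundary points give [g]. *)
Lemma cell_disjoint s g s' g' e : size (turns o s) = m -> size (turns o s') = m ->
  cell s g e -> cell s' g' e -> s = s' /\ g = g'.
Proof.
move=> sm sm' [z /= [hz hp df eb]] [z' /= [hz' hp' df' eb']].
set f := Ppoly m.+1 e.1 in hp df hp' df'.
have zz : forall p, (p < N)%N -> z p = z' p.
  have [|//] := @inc_mem_eq R z z' N N hz hz'.
  have cE : cprod (fun j => z (nth 0%N (turns o s) j)) m =
      cprod (fun j => z' (nth 0%N (turns o s') j)) m.
    have : m.+1%:R *: cprod (fun j => z (nth 0%N (turns o s) j)) m =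
      m.+1%:R *: cprod (fun j => z' (nth 0%N (turns o s') j)) m by rewrite -df -df'.
    by apply: scalerI; rewrite pnatr_eq0.
  move=> x; rewrite -(perm_mem (special_points sm eb)) -(perm_mem (special_points sm' eb')).
  rewrite !mem_cat; congr (_ || _).
  by have := root_cprod (fun j => z (nth 0%N (turns o s) j)) m x; rewrite cE root_cprod => ->.
have vE (p : 'I_N) : f.[z p] = f.[z' p] by rewrite zz.
have ss : s = s'.
  apply: perm_order_eq => p q.
  have H (t t' : 'S_N) y y' : has_pattern t (fun p => f.[y p]) ->
      has_pattern t' (fun p => f.[y' p]) -> (forall p : 'I_N, f.[y p] = f.[y' p]) ->
      (t p < t q)%N -> (t' p < t' q)%N.
    move=> h h' yy /h; rewrite !yy ltNge => pq.
    rewrite ltn_neqAle leqNgt; apply/andP; split.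
      apply: contraNneq pq => /val_inj/perm_inj ->; exact: lexx.
    by apply: contraNN pq => /h' /ltW.
  by apply/idP/idP; [apply: H hp hp' vE | apply: H hp' hp _ => r; rewrite vE].
subst s'; split => //; apply/permP => i; apply/val_inj.
have := eb i; rewrite eb' -zz ?flats_ltn // => /(inc_inj hz).
move=> /(_ (flats_ltn _ sm) (flats_ltn _ sm)) /eqP.
by rewrite nth_uniq ?filter_uniq ?iota_uniq ?size_flats // => /eqP.
Qed.

End CellPartition.

(** * Cells cover the very nice configurations *)

Section CellCover.
Variables (R : realType).
Implicit Types (c z v : nat -> R).

Lemma exists_pattern N v : (forall p q, (p < N)%N -> (q < N)%N -> v p = v q -> p = q) ->
  exists s : 'S_N, has_pattern s v.
Proof.
move=> vi; pose A (p : 'I_N) := [set q : 'I_N | v q < v p]%SET.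
have Alt p : (#|A p| < N)%N.
  have : A p \proper [set: 'I_N]%SET.
    by apply/properP; split; [exact: finset.subsetT | exists p; rewrite ?inE ?ltxx].
  by move/proper_card; rewrite cardsT card_ord.
have Ale (p q : 'I_N) : v p <= v q -> (#|A p| <= #|A q|)%N.
  move=> pq; apply/subset_leq_card/fintype.subsetP => r; rewrite !inE => rp.
  exact: lt_le_trans pq.
have Amono (p q : 'I_N) : v p < v q -> (#|A p| < #|A q|)%N.
  move=> pq; apply: proper_card; apply/properP; split.
    by apply/fintype.subsetP => r; rewrite !inE => /lt_trans; apply.
  by exists p; rewrite !inE ?ltxx.
have inj : injective (fun p => Ordinal (Alt p)).
  move=> p q /(congr1 val) /= e.
  apply/val_inj/(vi _ _ (ltn_ord p) (ltn_ord q))/le_anti; rewrite !leNgt.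
  by apply/andP; split; apply/negP => /Amono; rewrite e ltnn.
exists (perm inj) => p q; rewrite !permE /=.
by case: leP => // /Ale; rewrite leqNgt => /negbTE ->.
Qed.

Lemma pattern_lt N (s : 'S_N) v (p q : 'I_N) : has_pattern s v ->
  p != q -> (s p < s q)%N = (v p < v q).
Proof.
move=> hv pq; have [lt|lt|] := ltngtP (s p) (s q).
- by rewrite (hv _ _ lt).
- by have := hv _ _ lt; rewrite ltNge => /negbTE h; rewrite lt_neqAle [X in _ && X]leNgt (hv _ _ lt) andbF.
by move=> /val_inj/perm_inj e; rewrite e eqxx in pq.
Qed.

Variables (m l : nat).
Local Notation N := (m + l)%N.
Local Notation o := (odd m).
Local Notation config := ('rV[R]_(m.+1 - 2) * 'rV[R]_l)%type.
Implicit Types (e : config) (s : 'S_N) (g : 'S_l).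

(** Here [P] marks the positions of the critical points. Between consecutive special points f is
    monotone, with sign given by the number of critical points to come, so the directions of [s]
    flip exactly on [P]; the sentinels supply both ends. *)
Lemma critpoly_turns s z P :
  inc z N -> before P N = m ->
  has_pattern s (fun p => (critpoly (fun j => z (nth 0%N [seq p <- iota 0 N | P p] j)) m).[z p]) ->
  {in gtn N, turn o s =1 P}.
Proof.
move=> hz bN hp; set S := [seq p <- iota 0 N | P p] in hp.
have sS : size S = m by rewrite size_filter_iota.
have ble q : (q <= N)%N -> (before P q <= m)%N by move=> qN; rewrite -[X in (_ <= X)%N]bN before_mono.
set c := (fun j => z _) in hp.
have ascE q : (q <= N)%N -> asc o s q = ~~ odd (m - before P q).
  have [->|q0] := posnP q => qN.
    have [N0|N0] := posnP N; last by rewrite asc0 // subn0.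
    have m0 : m = 0%N by lia.
    by rewrite /asc /lev insubF ?N0 // m0.
  move: qN; rewrite leq_eqVlt => /predU1P[qE|qN]; first by rewrite qE bN subnn ascN // -qE.
  have qN' : (q.-1 < N)%N by lia.
  have := @critpoly_mono R c m (before P q) (z q.-1) (z q) _ _.
  have zz : z q.-1 < z q by apply: hz => //; lia.
  move=> /(_ zz) => h.
  have {h} : 0 < (-1) ^+ (m - before P q) * ((critpoly c m).[z q] - (critpoly c m).[z q.-1]).
    apply: h => x /andP[zx xz] j jm; have jS : (j < size S)%N by rewrite sS.
    have [_ jN _] := nth_filterP jS.
    rewrite -(nth_filter_ltE _ jS); case: ltnP => jq.
      by apply: le_lt_trans zx; apply: inc_le hz _ qN'; rewrite -ltnS prednK.
    by apply: lt_le_trans xz _; apply: inc_le hz jq _.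
  rewrite -signr_odd /asc.
  have := levS o s (Ordinal qN); have := levS o s (Ordinal qN'); rewrite /= prednK // => -> ->.
  rewrite ltnS (pattern_lt hp); last by apply/negP => /eqP/(congr1 val) /=; lia.
  case: odd => /=; rewrite ?expr1 ?mulN1r ?oppr_gt0 ?subr_lt0 ?mul1r ?subr_gt0.
    by move=> lt; rewrite lt_neqAle [X in _ && X]leNgt lt andbF.
  by move=> ->.
move=> q qN; rewrite inE in qN.
rewrite /turn !ascE ?(ltnW qN) // beforeS.
have := ble q.+1 qN; rewrite beforeS => bq.
have -> : (m - before P q = m - (before P q + P q) + P q)%N by lia.
by rewrite oddD oddb; case: (odd _); case: (P q).
Qed.

(** The permutation is the pattern of the values at the sorted special points; the labelling sends a
    label to the rank of its point among the flats. *)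
Lemma cell_cover e : very_nice R m.+1 l e ->
  exists s g, size (turns o s) = m /\ cell s g e.
Proof.
move=> [r [sr df ur]]; set f := Ppoly m.+1 e.1 in df ur.
pose B := [seq e.2 0 i | i <- enum 'I_l]; pose L := r ++ B.
have {ur} ufL : uniq (map (horner f) L).
  have -> : map (horner f) L = [seq f.[x] | x <- r] ++ [seq f.[e.2 0 i] | i <- enum 'I_l].
    by rewrite map_cat /B; congr (_ ++ _); rewrite -[LHS]map_comp; apply: eq_map.
  exact: ur.
have uL : uniq L := map_uniq ufL.
have sL : size L = N by rewrite size_cat sr size_map size_enum_ord.
pose ZL := sort <=%O L; pose z p := nth 0 ZL p.
have sZ : size ZL = N by rewrite size_sort.
have mZ x : (x \in ZL) = (x \in L) by rewrite mem_sort.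
have hz : inc z N.
  have /(sortedP 0) st : sorted <%O ZL by rewrite sort_lt_sorted.
  by apply: inc_step => i im; apply: st; rewrite sZ.
have vi p q : (p < N)%N -> (q < N)%N -> f.[z p] = f.[z q] -> p = q.
  move=> pN qN pq; apply/eqP.
  have : uniq (map (horner f) ZL) by rewrite (perm_uniq (perm_map _ (permEl (perm_sort _ _)))).
  move/(nth_uniq 0) => <-; rewrite ?size_map ?sZ //.
  by rewrite !(nth_map 0) ?sZ // pq.
have [s hs] := exists_pattern vi.
pose P p := z p \in r; pose S := [seq p <- iota 0 N | P p].
have zL p : (p < N)%N -> z p \in L by move=> pN; rewrite -mZ mem_nth ?sZ.
have rS : perm_eq (map z S) r.
  apply: uniq_perm.
  - rewrite map_inj_in_uniq ?filter_uniq ?iota_uniq // => p q.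
    by rewrite !mem_filter !mem_iota !add0n => /andP[_ pN] /andP[_ qN]; apply: inc_inj hz _ _.
  - by move: uL; rewrite cat_uniq => /andP[].
  move=> x; apply/mapP/idP => [[p]|xr]; first by rewrite mem_filter => /andP[? _] ->.
  have : x \in ZL by rewrite mZ mem_cat xr.
  move/(nthP 0) => [p]; rewrite sZ => pN xE; exists p => //.
  by rewrite /S mem_filter mem_iota leq0n add0n pN /P /z xE xr.
have bPN : before P N = m.
  by rewrite -size_filter_iota -/S -(size_map z) (perm_size rS).
have df' : deriv f = m.+1%:R *: cprod (fun j => z (nth 0%N S j)) m.
  rewrite df cprod_seq; congr (_ *: _); rewrite -(perm_big _ rS) /=.
  congr (\big[_/_]_(x <- _) _).
  by rewrite -[in LHS](@mkseq_nth _ 0%N S) -map_comp size_filter_iota -/(before P N) bPN.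
have [_ fE _] := Ppoly_critpoly df'.
have tP : {in gtn N, turn o s =1 P}.
  by apply: (critpoly_turns hz bPN); rewrite -/S -fE.
have tE : turns o s = S.
  by apply: eq_in_filter => p; rewrite mem_iota add0n => pN; apply: tP.
have sm : size (turns o s) = m by rewrite tE size_filter_iota.
have sf := size_flats sm.
pose nt p := ~~ turn o s p.
have ex (i : 'I_l) : exists p, [/\ (p < N)%N, nt p & z p = e.2 0 i].
  have iB : e.2 0 i \in B by apply/mapP; exists i; rewrite ?mem_enum.
  have : e.2 0 i \in ZL by rewrite mZ mem_cat iB orbT.
  move/(nthP 0) => [p]; rewrite sZ => pN pE; exists p; split=> //.
  rewrite /nt tP ?inE // /P /z pE; apply/negP => ir.
  move: uL; rewrite cat_uniq => /and3P[_ /hasPn h _].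
  by have := h _ iB; rewrite /= ir.
have /choice[p hp] := ex.
have bl i : (before nt (p i) < l)%N.
  have [pN np _] := hp i; rewrite -sf /flats size_filter_iota; exact: before_lt.
have nthp i : nth 0%N (flats o s) (before nt (p i)) = p i.
  by have [pN np _] := hp i; apply: nth_before.
have ginj : injective (fun i => Ordinal (bl i)).
  move=> i j /(congr1 val) /= e1.
  have pij : p i = p j by rewrite -nthp e1 nthp.
  have [pN _ pi] := hp i; have [_ _ pj] := hp j.
  have eij : e.2 0 i = e.2 0 j by rewrite -pi -pj pij.
  have uB : uniq B by move: uL; rewrite cat_uniq => /and3P[].
  by have /injectiveP bi : injectiveb (fun i : 'I_l => e.2 0 i) := uB; exact: bi.
exists s, (perm ginj); split => //; exists z; split => //.
  by rewrite tE.
by move=> i; rewrite permE /= nthp; have [_ _ ->] := hp i.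
Qed.

End CellCover.

(** * The number of components *)

Section Count.
Variable R : realType.

Lemma numK_formula m l :
  finite_set (components (very_nice R m.+1 l)) /\
  numK R l m.+1 = (l`! * nturns (odd m) (m + l) m)%N.
Proof.
pose I := {x : 'S_(m + l) * 'S_l | size (turns (odd m) x.1) == m}.
have [|||||fin card] := @card_components _ (very_nice R m.+1 l) I
  (fun x => cell (val x).1 (val x).2).
- apply/seteqP; split => [e /cell_cover[s [g [/eqP sm h]]]|e [[x /= /eqP sm] _]].
    by exists (exist _ (s, g) sm).
  exact: cell_sub.
- by move=> [x /= /eqP sm]; exact: cell_connected.
- by move=> [x /= /eqP sm]; exact: cell_nonempty.
- move=> [[s g] /= hx] [[s' g'] /= hy] e cx cy; apply/val_inj => /=.
  by have [-> ->] := cell_disjoint (eqP hx) (eqP hy) cx cy.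
- by move=> [x /= /eqP sm] e; exact: cell_open.
split=> //; rewrite /numK card card_sig.
have -> : #|[pred x : 'S_(m + l) * 'S_l | size (turns (odd m) x.1) == m]| =
    #|finset.setX [set s : 'S_(m + l) | size (turns (odd m) s) == m]%SET [set: 'S_l]%SET|.
  by apply: eq_card => -[s g]; rewrite !inE andbT.
by rewrite cardsX cardsT card_Sn mulnC.
Qed.

End Count.

(** * The recurrence and the generating function *)

Section Recurrence.
Variable R : realType.

Lemma very_nice0_small l : (l <= 1)%N -> very_nice R 0 l = setT.
Proof.
move=> l1; apply/seteqP; split=> // e _; exists [::]; split=> //.
  by rewrite /Ppoly /= deriv0 scale0r.
case: l l1 e => [|[|//]] _ e; first by rewrite /= (size0nil (size_enum_ord 0)).
have : size [seq (Ppoly 0 e.1).[e.2 0 i] | i <- enum 'I_1] = 1%N.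
  by rewrite size_map size_enum_ord.
by case: [seq _ | _ <- _] => [|? []].
Qed.

Lemma very_nice0_large l : (1 < l)%N -> very_nice R 0 l = set0.
Proof.
move=> l1; apply/seteqP; split=> // e [s [_ _]]; rewrite cat_uniq => /and3P[_ _ u].
have /injectiveP inj : injectiveb (fun i : 'I_l => (Ppoly 0 e.1).[e.2 0 i]) := u.
have := inj (Ordinal (ltnW l1)) (Ordinal l1); rewrite /Ppoly /= !horner0.
by move=> /(_ erefl)/(congr1 val).
Qed.

Lemma components_very_nice0 l : finite_set (components (very_nice R 0 l)) /\
  numK R l 0 = (l <= 1)%N :> nat.
Proof.
rewrite /numK; have [l1|l1] := leqP l 1; last first.
  by rewrite very_nice0_large // /components image_set0 fset_set0 cardfs0.
rewrite very_nice0_small //.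
have [| | | | |? ->] := @card_components _ setT unit (fun=> [set: 'rV[R]_(0 - 2) * 'rV[R]_l]).
- by apply/seteqP; split=> // x _; exists tt.
- move=> _; pose h (t : R) : 'rV[R]_(0 - 2) * 'rV[R]_l := (0, \row_i t).
  have -> : [set: 'rV[R]_(0 - 2) * 'rV[R]_l] = h @` setT.
    (* With at most one entry, a row is constant with the sum of its entries as value, so a line
       covers the space. *)
    apply/seteqP; split=> // -[a b] _; exists (\sum_i b 0 i) => //.
    rewrite /h; congr (_, _); apply/rowP => i; first by case: i.
    rewrite mxE (bigD1 i) //= big1 ?addr0 // => j /negP[].
    by apply/eqP/val_inj => /=; have := ltn_ord i; have := ltn_ord j; lia.
  apply: connected_continuous_connected; first by apply/connected_intervalP => x y _ _ w _.
  apply: continuous_subspaceT => t.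
  have A1 : (fun=> 0 : 'rV[R]_(0 - 2)) x @[x --> t] --> (0 : 'rV[R]_(0 - 2)).
    exact: cvg_cst.
  have A2 : (\row_(i < l) x) @[x --> t] --> (\row_(i < l) t).
    by apply: cvg_row => i; exact: cvg_id.
  exact: (cvg_pair A1 A2).
- by move=> _; exists (0, 0).
- by case=> -[].
- by move=> _ x _; apply: filterS (@filterT _ (nbhs x) _).
by rewrite card_unit.
Qed.

Lemma nturns_gt o N k : (N < k)%N -> nturns o N k = 0%N.
Proof.
move=> Nk; apply: eq_card0 => s; rewrite !inE; apply/negP => /eqP e.
by have := size_turns_flats o s; lia.
Qed.

Lemma nturns1 : nturns true 1 1 = 1%N.
Proof.
transitivity #|[set: 'S_1]%SET|; last by rewrite cardsT card_Sn.
apply: eq_card => s; rewrite !inE size_turns big_ord1 /turn.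
by rewrite asc0 // (ascN true s).
Qed.

(** Additive form over the naturals; at l = 0 the factor [l] removes the term with [l.-1]. For n = m
    + 1 this is [nturnsS] at N = m + l + 1, k = m + 2, times l!: the coefficient N - m = l + 1 turns
    l! into (l + 1)!, and m + 3 = n + 2 is the other coefficient. For n = 0 the case k = 1 has only
    the first term, and K_0^1 = 1 is the starting value. *)
Lemma numK_rec l n :
  (numK R l.+1 n + l * n.+2 * numK R l.-1 n.+2 = numK R l n.+2)%N.
Proof.
have KE m k := (numK_formula R m k).2.
rewrite !KE; case: n => [|m].
  have [_ ->] := components_very_nice0 l.+1.
  case: l => [|l]; first by rewrite nturns1.
  rewrite -[l.+1.-1]/l !add1n (@nturnsS _ l.+1) // factS; nia.
rewrite KE /= negbK.
have -> : (m.+2 + l = (m + l.+1).+1)%N by lia.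
rewrite nturnsS; last by lia.
have -> : (m + l.+1 - m = l.+1)%N by lia.
case: l => [|l] /=.
  by rewrite (@nturns_gt _ (m + 1) m.+2) ?addn1 // -[1`!]/1%N -[0`!]/1%N; lia.
have -> : (m.+2 + l = m + l.+2)%N by lia.
rewrite !factS; nia.
Qed.

End Recurrence.

(** * Coefficients of the differential equation *)

Section Series.
Variable R : realType.
Implicit Types f g : fps2 R.

(** After expansion every left factor in the equation is a monomial, so multiplication becomes an
    index shift. *)
Lemma fps2_mul_monomial a b (c : R) g f i j :
  (forall p q, g p q = if (p == a) && (q == b) then c else 0) ->
  fps2_mul g f i j = if (a <= i)%N && (b <= j)%N then c * f (i - a)%N (j - b)%N else 0.
Proof.
move=> gE; rewrite /fps2_mul.
have [ai|ai] := leqP a i; last first.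
  rewrite /= big1 // => p _; rewrite big1 // => q _.
  have -> : g p q = 0 by rewrite gE; case: eqP => // pa; have := ltn_ord p; lia.
  by rewrite mul0r.
rewrite (bigD1 (Ordinal (ai : (a < i.+1)%N))) //= [X in _ + X]big1 ?addr0; last first.
  move=> p pa; rewrite big1 // => q _.
  have -> : g p q = 0 by rewrite gE; case: eqP => // e; case/eqP: pa; exact/val_inj.
  by rewrite mul0r.
have [bj|bj] := leqP b j; last first.
  rewrite big1 // => q _.
  have -> : g a q = 0 by rewrite gE eqxx /=; case: eqP => // pa; have := ltn_ord q; lia.
  by rewrite mul0r.
rewrite (bigD1 (Ordinal (bj : (b < j.+1)%N))) //= [X in _ + X]big1 ?addr0; last first.
  move=> q qb.
  have -> : g a q = 0 by rewrite gE eqxx /=; case: eqP => // e; case/eqP: qb; exact/val_inj.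
  by rewrite mul0r.
by rewrite gE !eqxx.
Qed.

Lemma fps2_mulBl f g (h : fps2 R) i j :
  fps2_mul (fps2_sub f g) h i j = fps2_mul f h i j - fps2_mul g h i j.
Proof.
rewrite /fps2_mul -sumrB; apply: eq_bigr => p _; rewrite -sumrB.
by apply: eq_bigr => q _; rewrite /fps2_sub mulrBl.
Qed.

Lemma fps2C_X (c : R) p q :
  fps2_mul (fps2C c) fps2X p q = if (p == 1%N) && (q == 0%N) then c else 0.
Proof.
rewrite (@fps2_mul_monomial 0 0 c) // /= !subn0 /fps2X.
by case: andP => _; rewrite ?mulr1 ?mulr0.
Qed.

Lemma fps2X_Y p q :
  fps2_mul (@fps2X R) fps2Y p q = if (p == 1%N) && (q == 1%N) then 1 else 0.
Proof.
rewrite (@fps2_mul_monomial 1 0 1) => [|p' q']; last by rewrite /fps2X; case: andP.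
by rewrite /fps2Y; case: p => [|[|p]]; case: q => [|[|q]]; rewrite /= ?mulr0 ?mulr1.
Qed.

Lemma genK_dyy (K00 : R) l n :
  fps2_dy (fps2_dy (genK K00)) l n = (numK R l n.+2)%:R / (l`! * n`!)%:R.
Proof.
rewrite /fps2_dy /genK andbF !factS -(mulr_natr (_ *+ _)) -(mulr_natr (_ / _)) !natrM.
have nz k : (k`!)%:R != 0 :> R by rewrite pnatr_eq0 -lt0n fact_gt0.
have nz' k : (k.+1)%:R != 0 :> R by rewrite pnatr_eq0.
move: (nz l) (nz n) (nz' n) (nz' n.+1) (numK R l n.+2)%:R.
move: (l`!)%:R (n`!)%:R n.+1%:R n.+2%:R => a d c b a0 d0 c0 b0 x.
by field; rewrite a0 b0 c0 d0.
Qed.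

End Series.

Theorem corollary4p3 (R : realType) (K00 : R) :
  (forall l n : nat, finite_set (components (very_nice R n l))) /\
  (let K := genK K00 in
   let K_x := fps2_dx K in
   let K_yy := fps2_dy (fps2_dy K) in
   let K_yyy := fps2_dy K_yy in
   K_x = ((fps2C 1 - fps2C 2 * fps2X) * K_yy - fps2X * fps2Y * K_yyy)%FPS).
Proof.
split=> [l [|m]|K K_x K_yy K_yyy].
- by have [] := components_very_nice0 R l.
- by have [] := numK_formula R m l.
have yyE i j : K_yy i j = (numK R i j.+2)%:R / (i`! * j`!)%:R by exact: genK_dyy.
have yyyE i j : K_yyy i j = (numK R i j.+3)%:R / (i`! * j.+1`!)%:R *+ j.+1.
  by rewrite -yyE.
have xE i j : K_x i j = (numK R i.+1 j)%:R / (i.+1`! * j`!)%:R *+ i.+1 by [].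
have nz k : (k`!)%:R != 0 :> R by rewrite pnatr_eq0 -lt0n fact_gt0.
have nz' k : (k.+1)%:R != 0 :> R by rewrite pnatr_eq0.
apply/funext => l; apply/funext => n.
rewrite [RHS]/fps2_sub fps2_mulBl (@fps2_mul_monomial R 0 0 1) //.
rewrite (@fps2_mul_monomial R 1 0 2); last exact: fps2C_X.
rewrite (@fps2_mul_monomial R 1 1 1); last exact: fps2X_Y.
have fM i j : (i`! * j`!)%:R = i`!%:R * j`!%:R :> R by rewrite natrM.
have fS i : i.+1`!%:R = i.+1%:R * i`!%:R :> R by rewrite factS natrM.
have f0 : 0`!%:R = 1 :> R by [].
rewrite xE !yyE yyyE !leq0n !subn0 !mul1r andbT -(numK_rec R l n) natrD.
rewrite (natrM _ (l * _)) (natrM _ l) !fM.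
(* At l = 0, and below at n = 0, the shift by x or by xy leaves the range and the corresponding term
   is zero. *)
case: l => [|l]; first by rewrite fS f0 !mul0r addr0 !mul1r mulr1n !subr0.
rewrite !subn1 -[l.+1.-1]/l ltn0Sn andTb -mulrnAl -(mulr_natr (numK _ _ _)%:R l.+2) !fS.
move: (nz l) (nz' l) (nz' l.+1); move: (l`!)%:R l.+1%:R l.+2%:R => a b c a0 b0 c0.
case: n => [|n].
  rewrite f0 ltnn subr0; move: (numK _ _ _)%:R (numK _ _ _)%:R => x y.
  by field; rewrite a0 b0 c0.
rewrite -[n.+1.-1]/n ltn0Sn -mulrnAl -(mulr_natr (numK _ _ _)%:R n.+1) !fS.
(* The factor of the recurrence splits into the 2 of the term 2x K_yy and the exponent of y coming
   from xy K_yyy. *)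
have -> : n.+3%:R = n.+1%:R + 2 :> R by rewrite -natrD addn2.
move: (nz n) (nz' n); move: (n`!)%:R n.+1%:R => d e d0 e0.
move: (numK _ _ _)%:R (numK _ _ _)%:R => x y.
by rewrite /=; field; rewrite a0 b0 c0 d0 e0.
Qed.
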